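(* Let $p_i$ denote the $i$th prime and for $n\ge1$ put $A_n=\sum_{i=1}^{2n}(-1)^ip_i$. Assume (i) Pillai's conjecture: $\bigl|\sum_{i=1}^{k}(-1)^{i-1}p_i\bigr|\sim \frac{p_k}{2}$ as $k\to\infty$; and (ii) $\#\{i:1\le i\le n,\ A_i\text{ is prime}\}\sim\frac{2n}{\log n}$ as $n\to\infty$. Let $r_k$ be the $k$th prime occurring in the sequence $(A_n)$. Then there exists a sequence of positive reals $(R_k)_{k\ge 2}$ with $\lim_{k\to\infty}R_k=1$ such that for all $k\ge 2$ $$r_k=\frac12 R_k^3\,k\log k\,\bigl(\log k+\log\log k+2\log R_k\bigr).$$
   Context: The sequence $(A_n)$ is strictly increasing, so its prime terms can be listed in increasing order $r_1<r_2<\cdots$. $\log$ is the natural logarithm. *)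

(* Defs.v *)
From mathcomp Require Import all_boot all_order all_algebra.
From mathcomp Require Import all_classical all_reals all_analysis.
Set Implicit Arguments.
Unset Strict Implicit.
Unset Printing Implicit Defensive.
Import Order.TTheory GRing.Theory Num.Theory.
Import numFieldNormedType.Exports.

Local Open Scope classical_set_scope.
Local Open Scope ring_scope.

(* The k-th (k >= 1, in increasing order) natural number satisfying P; the value
   is 0 when k = 0 and when fewer than k numbers satisfy P. *)
Definition kth_nat (P : pred nat) (k : nat) : nat :=
  xget 0%N [set m : nat | P m /\ count P (iota 0 m.+1) = k].

Definition nth_prime (i : nat) : nat := kth_nat prime i.

Definition A (n : nat) : int :=
  \sum_(1 <= i < (2 * n).+1) (-1) ^+ i * (nth_prime i)%:Z.

Definition primez (z : int) : bool := if z is Posz q then prime q else false.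

(* (A n) is strictly increasing, so the order of occurrence of its prime terms
   is the increasing order of their values. *)
Definition prime_term (k : nat) : nat :=
  kth_nat (fun q => prime q && `[< exists2 n : nat, (1 <= n)%N & A n = q%:Z >]) k.

(* Main.v *)
Require Import Defs.
From mathcomp Require Import all_boot all_order all_algebra.
From mathcomp Require Import all_classical all_reals all_analysis.
From mathcomp Require Import ring lra zify.
Set Implicit Arguments.
Unset Strict Implicit.
Unset Printing Implicit Defensive.
Import Order.TTheory GRing.Theory Num.Theory.
Import numFieldNormedType.Exports.
Local Open Scope classical_set_scope.
Local Open Scope ring_scope.

(* Given the two hypotheses, the conclusion amounts to the prime number theorem
   p_n ~ n log n: if n_k is the index of the k-th prime term, hypothesis (ii)
   gives k log n_k ~ 2 n_k, hence log n_k ~ log k, and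
   r_k = A_{n_k} ~ p_{2 n_k} / 2 ~ n_k log n_k ~ k (log k)^2 / 2. Moreover
   R^3 (c + 2 log R) increases from 0 to infinity on [exp (- c / 2), +oo[, so
   the equation defines R_k, and r_k ~ k (log k)^2 / 2 forces R_k --> 1.

   The prime number theorem is proved in the elementary way of Selberg and
   Erdos, with psi (N / n) always taken at the integer quotient. The
   Tatuzawa-Iseki identity turns Stirling's formula into Selberg's formula for
   E(N) = psi(N) - N, and iterating it gives
     |E(N)| (log N)^2 <= sum_{n <= N} L2(n) |E(N / n)| + O(N log N)
   where L2 = L log + L * L (L the von Mangoldt function) has mean value
   2 log n. Since sum E(n) / (n (n + 1)) is bounded, E is small at some point of
   each ]y, K y], and by Selberg's formula on a whole interval
   [z, (1 + 1/h) z] around it. These intervals carry a positive proportion of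
   the weight, so any constant alpha > 0 with |E(N)| <= alpha N for all large N
   can be improved by a fixed amount as long as alpha stays away from 0. *)

(** * Logarithms, harmonic sums and factorials *)

Ltac is_num n := lazymatch n with O => idtac | S ?m => is_num m end.
Ltac not_lit t := lazymatch t with
  | @GRing.natmul _ _ ?n => tryif is_num n then fail else idtac
  | _ => idtac end.
(* lra gives up on inverses of non-literals, and two such inverses that are only
   convertible (through different structures) are distinct atoms for it: ginv
   identifies and generalizes them. *)
Ltac ginv :=
  repeat match goal with
  | H : context [@GRing.inv _ ?t] |- _ => not_lit t; revert H end;
  repeat match goal with
  | |- context [@GRing.inv ?U ?t] => not_lit t;
    repeat match goal with |- context [@GRing.inv ?V ?s] =>
      tryif constr_eq_strict (@GRing.inv V s) (@GRing.inv U t) then fail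
      else (unify s t; change (@GRing.inv V s) with (@GRing.inv U t)) end;
    generalize (@GRing.inv U t) end;
  intros.
Ltac lrai := ginv; lra.

Section LogTools.
Variable R : realType.
Implicit Types (x y : R) (n m N d : nat).

Lemma ln_le_subr1 x : 0 < x -> ln x <= x - 1.
Proof.
move=> x0; have := @le_ln1Dx R (x - 1).
by rewrite addrCA subrr addr0; apply; lrai.
Qed.

Lemma ln_ge_1subV x : 0 < x -> 1 - x^-1 <= ln x.
Proof.
move=> x0; have := @ln_le_subr1 x^-1; rewrite invr_gt0 lnV ?posrE// => /(_ x0).
lrai.
Qed.

Lemma lnn_ge0 n : 0 <= ln n%:R :> R.
Proof. by case: n => [|n]; [rewrite ln0|rewrite ln_ge0// ler1n]. Qed.

Lemma ler_lnn n m : (0 < n)%N -> (n <= m)%N -> ln n%:R <= ln m%:R :> R.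
Proof.
by move=> n0 nm; rewrite ler_ln ?posrE ?ltr0n ?ler_nat// (leq_trans n0).
Qed.

Lemma lnS_sub_le n : (0 < n)%N -> ln n.+1%:R - ln n%:R <= n%:R^-1 :> R.
Proof.
move=> n0; have nR : 0 < n%:R :> R by rewrite ltr0n.
rewrite -ln_div ?posrE ?ltr0n//.
apply: (le_trans (ln_le_subr1 _)); first by rewrite divr_gt0// ltr0n.
rewrite -natr1 mulrDl divff ?gt_eqF// mul1r. lrai.
Qed.

Lemma lnS_sub_ge n : (0 < n)%N -> n.+1%:R^-1 <= ln n.+1%:R - ln n%:R :> R.
Proof.
move=> n0; have nR : 0 < n%:R :> R by rewrite ltr0n.
rewrite -ln_div ?posrE ?ltr0n//.
apply: le_trans (ln_ge_1subV _); last by rewrite divr_gt0// ltr0n.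
have : n.+1%:R != 0 :> R by rewrite pnatr_eq0.
rewrite -natr1 => h; rewrite invf_div.
by have -> : 1 - n%:R / (n%:R + 1) = (n%:R + 1 : R)^-1 by field.
Qed.

Lemma ln_le_2sqrt x : 0 < x -> ln x <= 2 * Num.sqrt x.
Proof.
move=> x0; have s0 : 0 < Num.sqrt x by rewrite sqrtr_gt0.
have -> : ln x = 2 * ln (Num.sqrt x).
  by rewrite -{1}(sqr_sqrtr (ltW x0)) lnXn// mulr2n; lrai.
have := ln_le_subr1 s0; lrai.
Qed.

(** With t = x^(1/4), ln x = 4 ln t <= 4 (t - 1). Together with [sum_invsqrt_le] this makes the sum
    over d <= N of (1 + ln (N / d))^2 an O(N). *)
Lemma sqr_ln1_le x : 1 <= x -> (1 + ln x) ^+ 2 <= 16 * Num.sqrt x.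
Proof.
move=> x1; have x0 : 0 < x by lrai.
set s := Num.sqrt x; have s0 : 0 < s by rewrite sqrtr_gt0.
have t0 : 0 < Num.sqrt s by rewrite sqrtr_gt0.
have E : ln x = 4 * ln (Num.sqrt s).
  rewrite -{1}(sqr_sqrtr (ltW x0)) lnXn// -/s -{1}(sqr_sqrtr (ltW s0)) lnXn//.
  by rewrite !mulr2n; lrai.
have l0 : 0 <= ln x by rewrite ln_ge0.
have h : 1 + ln x <= 4 * Num.sqrt s by rewrite E; have := ln_le_subr1 t0; lrai.
rewrite -[in leRHS](sqr_sqrtr (ltW s0)).
have -> : 16 * Num.sqrt s ^+ 2 = (4 * Num.sqrt s) ^+ 2 by ring.
by rewrite ler_sqr ?nnegrE//; lrai.
Qed.

Definition harm N : R := \sum_(1 <= k < N.+1) k%:R^-1.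

Lemma harmS N : harm N.+1 = harm N + N.+1%:R^-1.
Proof. by rewrite /harm big_nat_recr. Qed.

Lemma harm0 : harm 0 = 0.
Proof. by rewrite /harm big_geq. Qed.

Lemma ln_le_harm N : ln N.+1%:R <= harm N.
Proof.
elim: N => [|N IH]; first by rewrite harm0 ln1.
by rewrite harmS; have := lnS_sub_le (ltn0Sn N); lrai.
Qed.

Lemma harm_le_ln N : (0 < N)%N -> harm N <= ln N%:R + 1.
Proof.
elim: N => // -[|N] IH _; first by rewrite harmS harm0 ln1 invr1; lrai.
by rewrite harmS; have := lnS_sub_ge (ltn0Sn N); have := IH isT; lrai.
Qed.

(** The sequence [harm N - ln N] decreases, [harm N - ln (N + 1)] increases, and they differ by at
    most 1/N; the constant is the supremum of the latter. *)
Lemma euler_gamma : exists g : R, forall N, (0 < N)%N ->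
  `|harm N - ln N%:R - g| <= N%:R^-1.
Proof.
have mono m n : (0 < m)%N -> (m <= n)%N ->
    harm n - ln n%:R <= harm m - ln m%:R /\
    harm m - ln m.+1%:R <= harm n - ln n.+1%:R.
  move=> m0 mn; rewrite -(subnKC mn); elim: (n - m)%N => [|j [IH1 IH2]].
    by rewrite addn0.
  rewrite addnS harmS; have mj : (0 < m + j)%N by lia.
  have := lnS_sub_ge mj; have := lnS_sub_le (ltn0Sn (m + j)).
  by split; lrai.
pose E : set R := [set y | exists2 n, (0 < n)%N & y = harm n - ln n.+1%:R].
have Eub N : (0 < N)%N -> ubound E (harm N - ln N%:R).
  move=> N0 y [n n0 ->]; have [nN|Nn] := leqP n N.
    have [_ h] := mono _ _ n0 nN; have := ler_lnn N0 (leqnSn N); lrai.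
  have [h _] := mono _ _ N0 (ltnW Nn); have := ler_lnn n0 (leqnSn n); lrai.
have E0 : nonempty E by exists (harm 1 - ln 2); exists 1%N.
exists (sup E) => N N0.
have h1 : sup E <= harm N - ln N%:R by apply: ge_sup => //; exact: Eub.
have h2 : harm N - ln N.+1%:R <= sup E.
  by apply: ub_le_sup; [exists (harm 1 - ln 1); exact: (Eub 1%N)|exists N].
rewrite ger0_norm ?subr_ge0//; have := lnS_sub_le N0; lrai.
Qed.

Lemma sum_invsqrt_le N :
  \sum_(1 <= d < N.+1) (Num.sqrt d%:R)^-1 <= 2 * Num.sqrt N%:R :> R.
Proof.
elim: N => [|N IH]; first by rewrite big_geq// sqrtr0 mulr0.
rewrite big_nat_recr//=.
set a := Num.sqrt N.+1%:R; set b := Num.sqrt N%:R in IH *.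
have a0 : 0 < a by rewrite sqrtr_gt0 ltr0n.
have b0 : 0 <= b by rewrite sqrtr_ge0.
have ab : a ^+ 2 = b ^+ 2 + 1 by rewrite !sqr_sqrtr// natr1.
suff : a^-1 <= 2 * (a - b) by lrai.
by rewrite -(ler_pM2r a0) mulVf ?gt_eqF//; nra.
Qed.

Definition lnfact N : R := \sum_(1 <= k < N.+1) ln k%:R.

Lemma lnfactS N : lnfact N.+1 = lnfact N + ln N.+1%:R.
Proof. by rewrite /lnfact big_nat_recr. Qed.

(** With [lnfact_le], this is Stirling's formula up to O(log N). The inductions use n (log (n+1) -
    log n) <= 1 and (n+1) (log (n+1) - log n) >= 1. *)
Lemma lnfact_ge N : N%:R * ln N%:R - N%:R <= lnfact N.
Proof.
elim: N => [|[|N] IH]; first by rewrite /lnfact big_geq// mul0r; lrai.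
  by rewrite lnfactS /lnfact big_geq// ln1; lrai.
rewrite lnfactS; have N0 : 0 < N.+1%:R :> R by rewrite ltr0n.
have := lnS_sub_le (ltn0Sn N); rewrite -(ler_pM2l N0) mulfV ?gt_eqF//.
rewrite -(natr1 N.+1); lrai.
Qed.

Lemma lnfact_le N : (0 < N)%N -> lnfact N <= N%:R * ln N%:R - N%:R + ln N%:R + 1.
Proof.
elim: N => // -[|N] IH _.
  by rewrite lnfactS /lnfact big_geq// ln1; lrai.
rewrite lnfactS; have N0 : 0 < N.+2%:R :> R by rewrite ltr0n.
have := lnS_sub_ge (ltn0Sn N); rewrite -(ler_pM2l N0) mulfV ?gt_eqF//.
have := IH isT; rewrite -(natr1 N.+1); lrai.
Qed.

End LogTools.

(** * Dirichlet convolution *)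

Section Dirichlet.
Variable R : realType.
Implicit Types (n m N d k p q : nat).

Lemma sum_multiples d N (G : nat -> R) : (0 < d)%N ->
  \sum_(1 <= k < (N %/ d).+1) G (d * k)%N = \sum_(1 <= n < N.+1 | (d %| n)%N) G n.
Proof.
move=> d0; elim: N => [|N IH]; first by rewrite div0n !big_geq.
rewrite [RHS]big_mkcond big_nat_recr//= -big_mkcond/= -IH.
have := divnS N d0; case: ifP => [dN e|_ ->]; last by rewrite add0n addr0.
by rewrite e add1n big_nat_recr//= -[(N %/ d).+1]/(true + N %/ d)%N -e mulnC divnK.
Qed.

Lemma div_bound N d k : (0 < d)%N -> (k <= N %/ d)%N = (d * k <= N)%N.
Proof. by move=> d0; rewrite leq_divRL// mulnC. Qed.

Lemma sum_div_cond N d (F : nat -> R) : (0 < d)%N ->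
  \sum_(1 <= k < (N %/ d).+1) F k = \sum_(1 <= k < N.+1 | (d * k <= N)%N) F k.
Proof.
move=> d0; rewrite (big_nat_widen _ _ N.+1) ?ltnS ?leq_div//.
by apply: eq_bigl => k; rewrite ltnS div_bound.
Qed.

Lemma hyperbola_exchange N (F : nat -> nat -> R) :
  \sum_(1 <= d < N.+1) \sum_(1 <= k < (N %/ d).+1) F d k =
  \sum_(1 <= k < N.+1) \sum_(1 <= d < (N %/ k).+1) F d k.
Proof.
transitivity (\sum_(1 <= d < N.+1) \sum_(1 <= k < N.+1)
    if (d * k <= N)%N then F d k else 0).
  by apply: eq_big_nat => d /andP[d0 _]; rewrite sum_div_cond// big_mkcond.
rewrite exchange_big/=; apply: eq_big_nat => k /andP[k0 _].
rewrite sum_div_cond// [RHS]big_mkcond; apply: eq_bigr => d _.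
by rewrite mulnC.
Qed.

Lemma sum_divisors_widen n N (P : pred nat) (F : nat -> R) :
  (0 < n)%N -> (n <= N)%N ->
  \sum_(1 <= d < n.+1 | (d %| n)%N && P d) F d =
  \sum_(1 <= d < N.+1 | (d %| n)%N && P d) F d.
Proof.
move=> n0 nN; rewrite (big_nat_widen _ _ N.+1)//; apply: eq_bigl => d.
rewrite ltnS; case: (boolP (d %| n)%N) => //= dn.
by rewrite (dvdn_leq n0 dn) andbT.
Qed.

Lemma sum_divisors_widenT n N (F : nat -> R) :
  (0 < n)%N -> (n <= N)%N ->
  \sum_(1 <= d < n.+1 | (d %| n)%N) F d =
  \sum_(1 <= d < N.+1 | (d %| n)%N) F d.
Proof.
move=> n0 nN; rewrite (big_nat_widen _ _ N.+1)//; apply: eq_bigl => d.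
by rewrite ltnS; case: (boolP (d %| n)%N) => //= /(dvdn_leq n0) ->.
Qed.

(** Both sides run over the pairs (d, k) with d k <= N, grouped on the right by n = d k. *)
Lemma dirichlet_sum N (G : nat -> nat -> R) :
  \sum_(1 <= d < N.+1) \sum_(1 <= k < (N %/ d).+1) G d (d * k)%N =
  \sum_(1 <= n < N.+1) \sum_(1 <= d < n.+1 | (d %| n)%N) G d n.
Proof.
transitivity (\sum_(1 <= d < N.+1) \sum_(1 <= n < N.+1)
    if (d %| n)%N then G d n else 0).
  by apply: eq_big_nat => d /andP[d0 _]; rewrite sum_multiples// big_mkcond.
rewrite exchange_big/=; apply: eq_big_nat => n /andP[n0 nN].
by rewrite -big_mkcond/= (@sum_divisors_widenT n N).
Qed.

(** Both sides run over the pairs (d, e) with d e dividing n. *)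
Lemma divisor_pair_exchange n (F : nat -> nat -> R) :
  (0 < n)%N ->
  \sum_(1 <= d < n.+1 | (d %| n)%N)
    \sum_(1 <= e < (n %/ d).+1 | (e %| n %/ d)%N) F d e =
  \sum_(1 <= e < n.+1 | (e %| n)%N)
    \sum_(1 <= d < (n %/ e).+1 | (d %| n %/ e)%N) F d e.
Proof.
move=> n0.
have key (G : nat -> nat -> R) :
  \sum_(1 <= d < n.+1 | (d %| n)%N)
    \sum_(1 <= e < (n %/ d).+1 | (e %| n %/ d)%N) G d e =
  \sum_(1 <= d < n.+1) \sum_(1 <= e < n.+1) if (e * d %| n)%N then G d e else 0.
  rewrite big_mkcond/=; apply: eq_big_nat => d /andP[d0 _].
  case: ifP => [dn|/negP dn]; last first.
    rewrite big1// => e _; case: ifP => // edn; case: dn.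
    by apply: dvdn_trans edn; rewrite dvdn_mull.
  have nd0 : (0 < n %/ d)%N by rewrite divn_gt0// dvdn_leq.
  rewrite (sum_divisors_widenT _ nd0 (leq_div n d)) big_mkcond/=.
  by apply: eq_bigr => e _; rewrite dvdn_divRL.
rewrite key (key (fun e d => F d e)) exchange_big/=.
by apply: eq_bigr => e _; apply: eq_bigr => d _; rewrite mulnC.
Qed.

(** By unique factorization at most one pair (p, k) contributes. Since p <= p^k and k < p^k, both
    ranges can be widened at will, as [mangoldt_widen] does before sums are exchanged. *)
Definition mangoldt n : R :=
  \sum_(1 <= p < n.+1 | prime p) \sum_(1 <= k < n.+1 | n == (p ^ k)%N) ln p%:R.

Lemma mangoldt_widen n N : (n <= N)%N ->
  mangoldt n =
  \sum_(1 <= p < N.+1 | prime p) \sum_(1 <= k < N.+1 | n == (p ^ k)%N) ln p%:R.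
Proof.
move=> nN; rewrite /mangoldt (big_nat_widen _ _ N.+1)// big_mkcondr/=.
rewrite big_seq_cond [RHS]big_seq_cond; apply: eq_bigr => p.
move=> /andP[_ pp].
have -> : \sum_(1 <= k < N.+1 | n == (p ^ k)%N) ln p%:R =
          \sum_(1 <= k < n.+1 | n == (p ^ k)%N) ln p%:R :> R.
  rewrite [RHS](big_nat_widen _ _ N.+1)//; apply: eq_bigl => k.
  case: eqP => //= ->; rewrite ltnS; apply/esym/ltnW.
  by rewrite ltn_expl// prime_gt1.
case: ifP => // /negbT; rewrite -leqNgt => np.
rewrite big_nat_cond big1// => k /andP[/andP[k0 _] /eqP nE].
move: np; rewrite nE ltnNge => /negP[].
by rewrite -{1}(expn1 p) leq_exp2l// prime_gt1.
Qed.

Lemma mangoldt_ge0 n : 0 <= mangoldt n.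
Proof. by apply: sumr_ge0 => p _; apply: sumr_ge0 => k _; exact: lnn_ge0. Qed.

Lemma ln_prodn (I : Type) (s : seq I) (P : pred I) (F : I -> nat) :
  (forall i, P i -> (0 < F i)%N) ->
  ln (\prod_(i <- s | P i) F i)%:R = \sum_(i <- s | P i) ln (F i)%:R :> R.
Proof.
move=> F0; suff [] : (0 < \prod_(i <- s | P i) F i)%N /\
  ln (\prod_(i <- s | P i) F i)%:R = \sum_(i <- s | P i) ln (F i)%:R :> R by [].
elim/big_rec2: _ => [|i x y Pi [x0 <-]]; first by rewrite ln1.
by rewrite muln_gt0 F0// natrM lnM ?posrE ?ltr0n ?F0.
Qed.

Lemma ln_logn n : (0 < n)%N ->
  ln n%:R = \sum_(1 <= p < n.+1 | prime p) (logn p n)%:R * ln p%:R :> R.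
Proof.
move=> n0; have := partnT n0; rewrite /partn => {1}<-.
have l0 : logn 0 n = 0%N by rewrite lognE.
rewrite big_ltn// l0 expn0 mul1n.
rewrite big_nat_cond ln_prodn; last first.
  by move=> p /andP[/andP[p0 _] _]; rewrite expn_gt0 p0.
rewrite -big_nat_cond [RHS]big_mkcond/=; apply: eq_big_nat => p /andP[p0 _].
rewrite natrX lnXn ?ltr0n// mulr_natl; case: ifP => // pp.
by rewrite lognE pp.
Qed.

(** The powers p^k dividing n are those with 1 <= k <= [logn p n], each contributing log p; the
    total is the factorization of n in [ln_logn]. *)
Lemma sum_mangoldt_dvd n : (0 < n)%N ->
  \sum_(1 <= d < n.+1 | (d %| n)%N) mangoldt d = ln n%:R.
Proof.
move=> n0; rewrite ln_logn// big_mkcond/=.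
transitivity (\sum_(1 <= d < n.+1) \sum_(1 <= p < n.+1 | prime p)
  \sum_(1 <= k < n.+1) if (d %| n)%N && (d == (p ^ k)%N) then ln p%:R else 0 : R).
  apply: eq_big_nat => d /andP[d0 dn]; case: ifP => dvd.
    rewrite (@mangoldt_widen d n)//; apply: eq_bigr => p _.
    by rewrite big_mkcond.
  by rewrite big1// => p _; rewrite big1.
rewrite exchange_big/=; apply: eq_bigr => p pp; rewrite exchange_big/=.
transitivity (\sum_(1 <= k < n.+1) if (p ^ k %| n)%N then ln p%:R else 0 : R).
  apply: eq_bigr => k _; rewrite -big_mkcond big_nat1_cond_eq.
  case: ifP => [/andP[_ ->]//|/negbT]; rewrite expn_gt0 prime_gt0//= ltnS.
  by case: ifP => // dv; rewrite (dvdn_leq n0 dv).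
rewrite -big_mkcond/=.
under eq_bigl do rewrite pfactor_dvdn//.
have L : (logn p n < n)%N by rewrite ltn_logl.
transitivity (\sum_(1 <= k < (logn p n).+1) ln p%:R : R).
  by rewrite [RHS](big_nat_widen _ _ n.+1) ?ltnS 1?ltnW.
by rewrite sumr_const_nat subn1 mulr_natl.
Qed.

Definition moebius n : R :=
  if all (fun p => logn p n == 1%N) (primes n) then (-1) ^+ size (primes n) else 0.

Lemma norm_moebius n : `|moebius n| <= 1.
Proof.
rewrite /moebius; case: ifP => _; last by rewrite normr0.
by rewrite normrX normrN1 expr1n.
Qed.

Lemma moebius_prime_mul p d : prime p -> (0 < d)%N ->
  moebius (p * d) = if (p %| d)%N then 0 else - moebius d.
Proof.
move=> pp d0; have p0 := prime_gt0 pp.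
have lE q : logn q (p * d) = ((q == p) + logn q d)%N.
  by rewrite lognM// logn_prime// eq_sym.
case: ifPn => pd.
  rewrite /moebius ifF//; apply/negP => /allP/(_ p).
  rewrite lE eqxx mem_primes pp muln_gt0 p0 d0 dvdn_mulr//= => /(_ isT).
  by move: pd; rewrite -{1}(expn1 p) pfactor_dvdn//; case: (logn p d).
have pm : perm_eq (primes (p * d)) (p :: primes d).
  apply: uniq_perm; first exact: primes_uniq.
    by rewrite /= primes_uniq andbT mem_primes (negPf pd) !andbF.
  by move=> q; rewrite primesM// primes_prime// inE in_cons.
rewrite /moebius (perm_all _ pm) (perm_size pm)/= lE eqxx.
have -> : logn p d = 0%N by rewrite lognE (negPf pd) !andbF.
rewrite /= (_ : all _ (primes d) = all (fun q => logn q d == 1%N) (primes d)).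
  by case: ifP => _; rewrite ?exprS ?mulN1r ?oppr0.
apply: eq_in_all => q qd; rewrite lE; case: (q =P p) => // qp.
by move: qd pd; rewrite qp mem_primes => /and3P[_ _ ->].
Qed.

(** For n > 1 write n = p m with p prime. The divisors p d with p not dividing d contribute - mu(d),
    which cancels the divisors prime to p; the divisors p d with p | d contribute 0. *)
Lemma sum_moebius n : (0 < n)%N ->
  \sum_(1 <= d < n.+1 | (d %| n)%N) moebius d = (n == 1%N)%:R.
Proof.
move=> n0; case: (ltngtP n 1) => [|n1|->]; [lia| |]; last first.
  by rewrite big_mkcond big_nat1 dvdn1/= /moebius.
have pp := pdiv_prime n1; set p := pdiv n in pp.
have p0 := prime_gt0 pp.
have nE : n = (p * (n %/ p))%N by rewrite mulnC divnK// pdiv_dvd.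
set m := (n %/ p)%N in nE.
have m0 : (0 < m)%N by move: n0; rewrite {1}nE muln_gt0 => /andP[].
have mn : (m <= n)%N by rewrite leq_div.
rewrite (bigID (fun d => (p %| d)%N))/=.
have -> : \sum_(1 <= d < n.+1 | (d %| n)%N && (p %| d)%N) moebius d =
    - \sum_(1 <= d < m.+1 | (d %| m)%N && ~~ (p %| d)%N) moebius d.
  under eq_bigl do rewrite andbC.
  rewrite big_mkcondr/= -sum_multiples// -/m -sumrN [RHS]big_mkcond/=.
  apply: eq_big_nat => k /andP[k0 _].
  rewrite {1}nE dvdn_pmul2l// moebius_prime_mul//.
  by case: (k %| m)%N; case: (p %| k)%N.
rewrite (sum_divisors_widen _ _ m0 mn).
apply/eqP; rewrite addrC subr_eq0; apply/eqP; apply: eq_bigl => d.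
case: (boolP (p %| d)%N) => pd; rewrite ?andbF ?andbT//.
by rewrite nE Gauss_dvdr// coprime_sym prime_coprime.
Qed.

(** Moebius inversion of [sum_mangoldt_dvd] gives the sum of mu(d) log (n / d). In log d = log n -
    log (n / d), the part log n contributes [n = 1] log n = 0. *)
Lemma sum_moebius_ln n : (0 < n)%N ->
  \sum_(1 <= d < n.+1 | (d %| n)%N) moebius d * ln d%:R = - mangoldt n.
Proof.
move=> n0.
have E : \sum_(1 <= d < n.+1 | (d %| n)%N) moebius d * ln (n %/ d)%:R = mangoldt n.
  transitivity (\sum_(1 <= d < n.+1 | (d %| n)%N)
      \sum_(1 <= e < (n %/ d).+1 | (e %| n %/ d)%N) moebius d * mangoldt e).
    rewrite big_seq_cond [RHS]big_seq_cond; apply: eq_bigr => d.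
    rewrite mem_index_iota => /andP[/andP[d0 dn] dv].
    by rewrite -mulr_sumr sum_mangoldt_dvd// divn_gt0// dvdn_leq.
  rewrite divisor_pair_exchange// big_mkcond/=.
  transitivity (\sum_(1 <= e < n.+1) if e == n then mangoldt n else 0).
    apply: eq_big_nat => e /andP[e0 en]; case: ifP => dv; last first.
      by case: eqP => // eE; rewrite eE dvdnn in dv.
    have ne0 : (0 < n %/ e)%N by rewrite divn_gt0// dvdn_leq.
    rewrite -mulr_suml (sum_moebius ne0).
    rewrite (_ : (n %/ e == 1)%N = (e == n)).
      by case: eqP => [->|_]; rewrite ?mul1r ?mul0r.
    by rewrite -(eqn_pmul2r e0) divnK// mul1n eq_sym.
  by rewrite -big_mkcond big_nat1_eq n0 ltnSn.
have S : \sum_(1 <= d < n.+1 | (d %| n)%N)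
      (moebius d * ln (n %/ d)%:R + moebius d * ln d%:R) = \sum_(1 <= d < n.+1 | (d %| n)%N) moebius d * ln n%:R.
  rewrite big_seq_cond [RHS]big_seq_cond; apply: eq_bigr => d.
  rewrite mem_index_iota => /andP[/andP[d0 dn] dv].
  have nd0 : (0 < n %/ d)%N by rewrite divn_gt0// dvdn_leq.
  by rewrite -mulrDr -lnM ?posrE ?ltr0n// -natrM divnK.
move: S; rewrite big_split/= E -mulr_suml sum_moebius//.
case: eqP => [->|_]; rewrite ?ln1 ?mulr0 ?mul0r => h; lra.
Qed.

End Dirichlet.

(** * Chebyshev, Mertens and Selberg *)

Section Selberg.
Variable R : realType.
Implicit Types (n m N d k p q : nat).
Local Notation mangoldt := (@mangoldt R).
Local Notation moebius := (@moebius R).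
Local Notation lnfact := (@lnfact R).
Local Notation harm := (@harm R).

Definition psi N : R := \sum_(1 <= n < N.+1) mangoldt n.

Lemma psi0 : psi 0 = 0.
Proof. by rewrite /psi big_geq. Qed.

Lemma psiS N : psi N.+1 = psi N + mangoldt N.+1.
Proof. by rewrite /psi big_nat_recr. Qed.

Lemma psi_le_mono m n : (m <= n)%N -> psi m <= psi n.
Proof.
move=> mn; rewrite /psi [leRHS](@big_cat_nat _ _ _ m.+1)//= lerDl.
by apply: sumr_ge0 => i _; exact: mangoldt_ge0.
Qed.

Lemma psi_ge0 n : 0 <= psi n.
Proof. by apply: sumr_ge0 => i _; exact: mangoldt_ge0. Qed.

Lemma mangoldt_le_ln n : (0 < n)%N -> mangoldt n <= ln n%:R.
Proof.
move=> n0; rewrite -sum_mangoldt_dvd// big_mkcond big_nat_recr//= dvdnn lerDr.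
by apply: sumr_ge0 => i _; case: ifP => // _; exact: mangoldt_ge0.
Qed.

Lemma lnfact_mangoldt N :
  lnfact N = \sum_(1 <= d < N.+1) mangoldt d * (N %/ d)%:R.
Proof.
transitivity (\sum_(1 <= n < N.+1) \sum_(1 <= d < n.+1 | (d %| n)%N) mangoldt d).
  by apply: eq_big_nat => n /andP[n0 _]; rewrite sum_mangoldt_dvd.
rewrite -(dirichlet_sum N (fun d _ => mangoldt d)); apply: eq_bigr => d _.
by rewrite sumr_const_nat subn1/= mulr_natr.
Qed.

Lemma lnfact_psi N : lnfact N = \sum_(1 <= k < N.+1) psi (N %/ k).
Proof.
rewrite lnfact_mangoldt /psi -(hyperbola_exchange N (fun d _ => mangoldt d)).
by apply: eq_bigr => d _; rewrite sumr_const_nat subn1/= mulr_natr.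
Qed.

(** On the right, Lambda(d) has a coefficient that is never negative, and is at least 1 for N / 2 <
    d <= N. *)
Lemma psi_half N : psi N - psi (N %/ 2) <= lnfact N - 2 * lnfact (N %/ 2).
Proof.
set h := (N %/ 2)%N; have hN : (h <= N)%N by rewrite leq_div.
have ext (F : nat -> R) : \sum_(1 <= d < h.+1) F d =
    \sum_(1 <= d < N.+1) if (d <= h)%N then F d else 0.
  by rewrite (big_nat_widen _ _ N.+1)// big_mkcond.
rewrite !lnfact_mangoldt /psi !ext mulr_sumr -!sumrB.
apply: ler_sum_nat => d /andP[d0 dN].
have hd : (2 * (h %/ d) <= N %/ d)%N.
  by rewrite /h divnAC mulnC leq_trunc_div.
have v0 := mangoldt_ge0 R d.
case: leqP => hdl; last first.
  have : 1 <= (N %/ d)%:R :> R by rewrite ler1n divn_gt0.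
  by nra.
have : 2 * (h %/ d)%:R <= (N %/ d)%:R :> R by rewrite -natrM ler_nat.
nra.
Qed.

(** Strong induction through [psi_half]: the Stirling bounds give at most 5 N for the range above N
    / 2, and the induction hypothesis 5 N for the rest. *)
Lemma chebyshev_psi N : psi N <= 10 * N%:R.
Proof.
have [n] := ubnP N; elim: n N => // n IH N; rewrite ltnS => Nn.
case: (ltnP N 2) => N2.
  case: N N2 {Nn} => [|[|//]] _; first by rewrite psi0; lra.
  by rewrite psiS psi0; have := @mangoldt_le_ln 1 isT; rewrite ln1; lra.
set h := (N %/ 2)%N; have h0 : (0 < h)%N by rewrite /h; lia.
have := IH h; rewrite /h => /(_ ltac:(lia)); rewrite -/h => IHh.
have N0 : (0 < N)%N by lia.
have := psi_half N; rewrite -/h.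
have := lnfact_ge R h; have := lnfact_le R N0.
have hN : 2 * h%:R <= N%:R :> R by rewrite -natrM ler_nat /h; lia.
have hN' : N%:R <= 2 * h%:R + 1 :> R by rewrite -natrM natr1 ler_nat /h; lia.
have lnN : ln N%:R <= ln 3 + ln h%:R :> R.
  rewrite -lnM ?posrE ?ltr0n// -natrM ler_lnn//; rewrite /h; lia.
have ln3 : ln 3 <= 2 :> R by have := @ln_le_subr1 R 3; lra.
have h1 : 1 <= h%:R :> R by rewrite ler1n.
have N1 : 1 <= N%:R :> R by rewrite ler1n.
have lh : ln h%:R <= h%:R - 1 :> R by apply: ln_le_subr1; lra.
have lN : ln N%:R <= N%:R - 1 :> R by apply: ln_le_subr1; lra.
have lh0 := lnn_ge0 R h; have lN0 := lnn_ge0 R N.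
have : N%:R * ln N%:R <= N%:R * (2 + ln h%:R) :> R.
  by rewrite ler_wpM2l//; lra.
have : (N%:R - 2 * h%:R) * ln h%:R <= 1 * ln h%:R :> R.
  by rewrite ler_wpM2r//; lra.
lra.
Qed.

Definition mertens_sum N : R := \sum_(1 <= n < N.+1) mangoldt n / n%:R.

Lemma floor_div_bounds N d : (0 < d)%N ->
  (N%:R / d%:R - 1 <= (N %/ d)%:R :> R) && ((N %/ d)%:R <= N%:R / d%:R :> R).
Proof.
move=> d0; have dR : 0 < d%:R :> R by rewrite ltr0n.
rewrite ler_pdivlMr// -natrM ler_nat leq_trunc_div andbT.
rewrite lerBlDr ler_pdivrMr// natr1 -natrM ler_nat.
by rewrite ltnW// ltn_ceil.
Qed.

(** In log N! = sum of Lambda(d) floor(N / d), removing the floors costs at most psi(N) = O(N);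
    Stirling's formula is then divided by N. *)
Lemma mertens N : (0 < N)%N -> `|mertens_sum N - ln N%:R| <= 12.
Proof.
move=> N0; have NR : 0 < N%:R :> R by rewrite ltr0n.
have h1 : lnfact N <= N%:R * mertens_sum N.
  rewrite lnfact_mangoldt mulr_sumr; apply: ler_sum_nat => d /andP[d0 _].
  have /andP[_ h] := floor_div_bounds N d0.
  rewrite mulrCA ler_wpM2l//; exact: mangoldt_ge0.
have h2 : N%:R * mertens_sum N - psi N <= lnfact N.
  rewrite lnfact_mangoldt mulr_sumr -sumrB; apply: ler_sum_nat => d /andP[d0 _].
  have /andP[h _] := floor_div_bounds N d0.
  have := mangoldt_ge0 R d => v0; rewrite mulrCA -{2}(mulr1 (mangoldt d)) -mulrBr.
  by rewrite ler_wpM2l.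
have := lnfact_ge R N; have := lnfact_le R N0; have := chebyshev_psi N.
have N1 : 1 <= N%:R :> R by rewrite ler1n.
have lN : ln N%:R <= N%:R - 1 :> R by apply: ln_le_subr1; lra.
move=> a b c; rewrite ler_norml.
by apply/andP; split; rewrite -(ler_pM2l NR); lra.
Qed.

(* F need not be a function of N / n: it may mix N %/ n with the real quotient. *)
Lemma tatuzawa_iseki N (F : nat -> R) : (0 < N)%N ->
  \sum_(1 <= d < N.+1) moebius d * (ln N%:R - ln d%:R) *
     \sum_(1 <= k < (N %/ d).+1) F (d * k)%N
  = F 1%N * ln N%:R + \sum_(1 <= n < N.+1) mangoldt n * F n.
Proof.
move=> N0; under eq_bigr do rewrite mulr_sumr.
rewrite (dirichlet_sum N (fun d n => moebius d * (ln N%:R - ln d%:R) * F n)).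
transitivity (\sum_(1 <= n < N.+1)
   ((if n == 1%N then F n * ln N%:R else 0) + mangoldt n * F n)).
  apply: eq_big_nat => n /andP[n0 _]; rewrite -mulr_suml.
  under eq_bigr do rewrite mulrBr.
  (* The coefficient of [F n] is the sum of mu(d) (log N - log d) over d | n, that is [n = 1] log N
     + Lambda(n). *)
  rewrite sumrB -mulr_suml sum_moebius// sum_moebius_ln// opprK mulrDl.
  by case: eqP => _; rewrite ?mul1r ?mul0r// [_ * F n]mulrC.
by rewrite big_split/= -big_mkcond big_nat1_eq !ltnS leq0n N0.
Qed.

Definition psierr N : R := psi N - N%:R.

(* The left-hand side is the inner sum of tatuzawa_iseki for
   F n = psi (N %/ n) - N / n + 1 + g, whose main terms cancel for g = gamma. *)
Lemma lnfact_harm_bound (g : R) M (x : R) :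
  (forall N, (0 < N)%N -> `|harm N - ln N%:R - g| <= N%:R^-1) ->
  (0 < M)%N -> M%:R <= x -> x <= M%:R + 1 ->
  `|lnfact M - x * harm M + (1 + g) * M%:R| <= (3 + `|g|) * (1 + ln x).
Proof.
move=> hg M0 Mx xM; have M1 : 1 <= M%:R :> R by rewrite ler1n.
have := hg M M0; set e := _ - g => he.
have -> : harm M = ln M%:R + g + e by rewrite /e; ring.
have lM : ln M%:R <= ln x by rewrite ler_ln ?posrE//; lra.
have lM0 := lnn_ge0 R M.
have := lnfact_ge R M; have := lnfact_le R M0.
have xe : `|x * e| <= 2.
  rewrite normrM ger0_norm; last by lra.
  have h : `|e| * M%:R <= 1 by rewrite -ler_pdivlMr ?mul1r//; lra.
  have := normr_ge0 e; nra.
have xg : `|(x - M%:R) * g| <= `|g|.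
  rewrite normrM ger0_norm; last by lra.
  have := normr_ge0 g; nra.
have xl : `|(x - M%:R) * ln M%:R| <= ln M%:R.
  rewrite normrM !ger0_norm//; last by lra.
  nra.
move=> a b; have := normr_ge0 g; set G := `|g| in xg * => G0.
have := ler_wpM2l G0 (_ : 0 <= ln x); rewrite mulr0 => /(_ ltac:(lra)).
move: xe xg xl; rewrite !ler_norml => /andP[? ?] /andP[? ?] /andP[? ?] ?.
by apply/andP; split; lra.
Qed.

(** [tatuzawa_iseki] is applied to an F within O(1) of [psierr (N %/ n)]. Its left-hand side is O(N)
    by [lnfact_harm_bound] and [sqr_ln1_le]. *)
Lemma selberg_psierr : exists C : R, 0 <= C /\ forall N, (0 < N)%N ->
  `|psierr N * ln N%:R + \sum_(1 <= n < N.+1) mangoldt n * psierr (N %/ n)|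
    <= C * N%:R.
Proof.
have [g hg] := euler_gamma R.
(* The summands bound, in order, the Tatuzawa-Iseki sum, the replacement of F by [psierr] under
   Lambda, and the term (1 + g) log N. *)
exists ((3 + `|g|) * 32 + (2 + `|g|) * 10 + (1 + `|g|)).
split; first by have := normr_ge0 g; lra.
move=> N N0; have NR : 0 < N%:R :> R by rewrite ltr0n.
pose F n : R := psi (N %/ n) - N%:R / n%:R + (1 + g).
have tat := tatuzawa_iseki F N0.
have bnd : `|F 1%N * ln N%:R + \sum_(1 <= n < N.+1) mangoldt n * F n|
    <= (3 + `|g|) * 32 * N%:R.
  rewrite -tat; apply: (le_trans (ler_norm_sum _ _ _)).
  apply: (@le_trans _ _ (\sum_(1 <= d < N.+1)
     ((3 + `|g|) * (16 * Num.sqrt N%:R)) * (Num.sqrt d%:R)^-1)).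
    apply: ler_sum_nat => d /andP[d0 dN].
    have dR : 0 < d%:R :> R by rewrite ltr0n.
    set x : R := N%:R / d%:R.
    have x1 : 1 <= x by rewrite ler_pdivlMr// mul1r ler_nat.
    have M0 : (0 < N %/ d)%N by rewrite divn_gt0.
    have -> : \sum_(1 <= k < (N %/ d).+1) F (d * k)%N =
        lnfact (N %/ d) - x * harm (N %/ d) + (1 + g) * (N %/ d)%:R.
      rewrite lnfact_psi /harm mulr_sumr -sumrB /F.
      have -> : (1 + g) * (N %/ d)%:R = \sum_(1 <= k < (N %/ d).+1) (1 + g).
        by rewrite sumr_const_nat subn1/= mulr_natr.
      rewrite -big_split/=; apply: eq_big_nat => k /andP[k0 _].
      by rewrite divnMA natrM invfM mulrA.
    have /andP[b1 b2] := floor_div_bounds N d0.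
    have ib := lnfact_harm_bound hg M0 b2 _; have {ib} := ib ltac:(rewrite /x; lra).
    rewrite -/x => ib.
    rewrite -ln_div ?posrE// -/x !normrM.
    have lx : 0 <= ln x by rewrite ln_ge0.
    rewrite (ger0_norm lx).
    have -> : (3 + `|g|) * (16 * Num.sqrt N%:R) / Num.sqrt d%:R =
        (3 + `|g|) * (16 * Num.sqrt x).
      by rewrite /x sqrtrM// sqrtrV// -!mulrA.
    apply: (@le_trans _ _ (1 * (1 + ln x) * ((3 + `|g|) * (1 + ln x)))).
      rewrite ler_pM ?mulr_ge0// ler_pM// ?norm_moebius//; lra.
    rewrite mul1r mulrCA -expr2 ler_wpM2l// ?sqr_ln1_le//.
  rewrite -mulr_sumr -!mulrA ler_wpM2l//.
  have := sum_invsqrt_le R N; rewrite -(ler_pM2l (_ : 0 < 16 * Num.sqrt N%:R)).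
    move=> h; apply: (le_trans _ (le_trans h _)); first by rewrite -mulrA.
    have := sqr_sqrtr (ltW NR); lra.
  by rewrite mulr_gt0// sqrtr_gt0.
have E : psierr N * ln N%:R + \sum_(1 <= n < N.+1) mangoldt n * psierr (N %/ n) =
   (F 1%N * ln N%:R + \sum_(1 <= n < N.+1) mangoldt n * F n)
   - (1 + g) * ln N%:R
   - \sum_(1 <= n < N.+1) mangoldt n * (F n - psierr (N %/ n)).
  under [X in _ - X]eq_bigr do rewrite mulrBr.
  rewrite sumrB /F /psierr divn1 invr1 mulr1; ring.
rewrite E.
have b2 : `|(1 + g) * ln N%:R| <= (1 + `|g|) * N%:R.
  rewrite normrM (ger0_norm (lnn_ge0 _ _)) ler_pM ?lnn_ge0//.
    by apply: (le_trans (ler_normD _ _)); rewrite normr1.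
  by have := ln_le_subr1 NR; lra.
have b3 : `|\sum_(1 <= n < N.+1) mangoldt n * (F n - psierr (N %/ n))|
    <= (2 + `|g|) * 10 * N%:R.
  apply: (le_trans (ler_norm_sum _ _ _)).
  apply: (@le_trans _ _ (\sum_(1 <= n < N.+1) mangoldt n * (2 + `|g|))).
    apply: ler_sum_nat => n /andP[n0 _]; rewrite normrM ger0_norm ?mangoldt_ge0//.
    rewrite ler_wpM2l ?mangoldt_ge0// /F /psierr.
    have /andP[c1 c2] := floor_div_bounds N n0.
    have := ler_norm g; have := ler_norm (- g); rewrite normrN => c3 c4.
    rewrite ler_norml; apply/andP; split; lrai.
  rewrite -mulr_suml -/(psi N) mulrC -mulrA ler_wpM2l//.
  exact: chebyshev_psi.
have := ler_normB (F 1%N * ln N%:R + \sum_(1 <= n < N.+1) mangoldt n * F n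
   - (1 + g) * ln N%:R) (\sum_(1 <= n < N.+1) mangoldt n * (F n - psierr (N %/ n))).
have := ler_normB (F 1%N * ln N%:R + \sum_(1 <= n < N.+1) mangoldt n * F n)
   ((1 + g) * ln N%:R).
lra.
Qed.

End Selberg.

(** * Increments of psi, the iterated Selberg inequality and its weight *)

Section SelbergConsequences.
Variable R : realType.
Implicit Types (n m N d k p q : nat).
Local Notation mangoldt := (@mangoldt R).
Local Notation lnfact := (@lnfact R).
Local Notation harm := (@harm R).
Local Notation psi := (@psi R).
Local Notation psierr := (@psierr R).

Lemma lnfact_le_mul N : lnfact N <= N%:R * ln N%:R.
Proof.
rewrite mulr_natl.
have -> : ln N%:R *+ N = \sum_(1 <= k < N.+1) ln N%:R :> R.
  by rewrite sumr_const_nat subn1.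
by apply: ler_sum_nat => k /andP[k0 kN]; rewrite ler_lnn.
Qed.

Lemma psierr_le N : `|psierr N| <= 10 * N%:R.
Proof.
have := chebyshev_psi R N; have := psi_ge0 R N; rewrite /psierr => a b.
have : 0 <= N%:R :> R by [].
by move=> c; rewrite ler_norml; apply/andP; split; lra.
Qed.

(** The main terms removed from psi are N log N and log N! = sum of Lambda(n) floor(N / n) = N log N
    + O(N). *)
Lemma selberg_psi : exists C : R, 0 <= C /\ forall N, (0 < N)%N ->
  `|psi N * ln N%:R + \sum_(1 <= n < N.+1) mangoldt n * psi (N %/ n)
    - 2 * N%:R * ln N%:R| <= C * N%:R.
Proof.
have [C [C0 hC]] := selberg_psierr R; exists (C + 1); split=> [|N N0]; first lra.
have := hC N N0.
have -> : \sum_(1 <= n < N.+1) mangoldt n * psierr (N %/ n) =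
    \sum_(1 <= n < N.+1) mangoldt n * psi (N %/ n) - lnfact N.
  by rewrite lnfact_mangoldt -sumrB; apply: eq_bigr => n _; rewrite -mulrBr.
have := lnfact_ge R N; have := lnfact_le_mul N.
rewrite /psierr => a b; rewrite !ler_norml => /andP[c d].
by apply/andP; split; lra.
Qed.

(** Both terms of [selberg_psi] grow with N, so its difference at u and z bounds (psi u - psi z) log
    z by 2 (u - z) log z + O(z). Subtracting (u - z) log z gives the upper bound; psi u >= psi z
    gives the lower one. *)
Lemma psierr_increment : exists C : R, 0 <= C /\ forall z u, (0 < z)%N ->
  (z <= u)%N -> (u <= 2 * z)%N ->
  `|psierr u - psierr z| * ln z%:R <= (u%:R - z%:R) * ln z%:R + C * z%:R.
Proof.
have [C [C0 hC]] := selberg_psi; exists (4 + 3 * C); split; first lra.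
move=> z u z0 zu uz; have u0 : (0 < u)%N by lia.
have zR : 0 < z%:R :> R by rewrite ltr0n.
have uR : 0 < u%:R :> R by rewrite ltr0n.
have zuR : z%:R <= u%:R :> R by rewrite ler_nat.
have uzR : u%:R <= 2 * z%:R :> R by rewrite -natrM ler_nat.
have lz := lnn_ge0 R z; have lu := lnn_ge0 R u.
have dpsi := psi_le_mono R zu.
have sle : \sum_(1 <= n < z.+1) mangoldt n * psi (z %/ n) <=
           \sum_(1 <= n < u.+1) mangoldt n * psi (u %/ n).
  rewrite [leRHS](@big_cat_nat _ _ _ z.+1)//=.
  apply: ler_wpDr.
    by apply: sumr_ge0 => n _; rewrite mulr_ge0 ?mangoldt_ge0 ?psi_ge0.
  apply: ler_sum => n _; rewrite ler_wpM2l ?mangoldt_ge0// psi_le_mono//.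
  exact: leq_div2r.
have := hC z z0; have := hC u u0.
rewrite !ler_norml => /andP[a1 a2] /andP[b1 b2].
have lzu : ln z%:R <= ln u%:R :> R by rewrite ler_lnn.
have lu2 : ln u%:R - ln z%:R <= 1 :> R.
  have : ln u%:R <= ln (2 * z%:R) :> R by rewrite ler_ln ?posrE//; lra.
  rewrite lnM ?posrE//; have := @ln_le_subr1 R 2; lra.
have lu3 : z%:R * (ln u%:R - ln z%:R) <= u%:R - z%:R :> R.
  rewrite -ln_div ?posrE//.
  apply: (@le_trans _ _ (z%:R * (u%:R / z%:R - 1))).
    by rewrite ler_wpM2l// ln_le_subr1// divr_gt0.
  by rewrite mulrBr mulr1 mulrC divfK ?gt_eqF.
have p1 : (psi u - psi z) * ln z%:R <= psi u * ln u%:R - psi z * ln z%:R.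
  have := psi_ge0 R u => pu; nra.
have p2 : (u%:R - z%:R) * (ln u%:R - ln z%:R) <= (u%:R - z%:R) * 1 :> R.
  by rewrite ler_wpM2l//; lra.
have D : (psi u - psi z) * ln z%:R <=
   2 * (u%:R - z%:R) * ln z%:R + (4 + 3 * C) * z%:R.
  have : C * u%:R <= C * (2 * z%:R) by rewrite ler_wpM2l.
  lra.
rewrite -[X in _ * X <= _](ger0_norm lz) -normrM ler_norml /psierr.
have D0 : 0 <= (psi u - psi z) * ln z%:R by rewrite mulr_ge0// subr_ge0.
have Cz : 0 <= (4 + 3 * C) * z%:R by rewrite mulr_ge0//; lra.
have : 0 <= (u%:R - z%:R) * ln z%:R :> R by rewrite mulr_ge0// subr_ge0.
by move=> h; apply/andP; split; lra.
Qed.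

Definition mangoldt2 n : R :=
  mangoldt n * ln n%:R +
  \sum_(1 <= d < n.+1 | (d %| n)%N) mangoldt d * mangoldt (n %/ d).

Lemma mangoldt2_ge0 n : 0 <= mangoldt2 n.
Proof.
rewrite addr_ge0 ?mulr_ge0 ?mangoldt_ge0 ?lnn_ge0//.
by apply: sumr_ge0 => d _; rewrite mulr_ge0 ?mangoldt_ge0.
Qed.

Lemma sum_mangoldt2 N (F : nat -> R) :
  \sum_(1 <= n < N.+1) mangoldt2 n * F n =
  \sum_(1 <= n < N.+1) mangoldt n * (ln n%:R * F n +
     \sum_(1 <= k < (N %/ n).+1) mangoldt k * F (n * k)%N).
Proof.
under [RHS]eq_bigr do rewrite mulrDr.
under [LHS]eq_bigr do rewrite mulrDl.
rewrite !big_split/=; congr (_ + _).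
  by apply: eq_bigr => n _; rewrite mulrA.
transitivity (\sum_(1 <= d < N.+1) \sum_(1 <= k < (N %/ d).+1)
    mangoldt d * mangoldt (d * k %/ d) * F (d * k)%N).
  rewrite (dirichlet_sum N (fun d n => mangoldt d * mangoldt (n %/ d) * F n)).
  by apply: eq_bigr => n _; exact: mulr_suml.
apply: eq_big_nat => d /andP[d0 _]; rewrite mulr_sumr; apply: eq_bigr => k _.
by rewrite mulKn// mulrA.
Qed.

(** Selberg's formula times log N, with log N = log n + log (N / n) + O(1) inside the sum; the part
    log (N / n) is bounded by Selberg's formula at N / n. [sum_mangoldt2] reassembles the weight. *)
Lemma psierr_ln2_le : exists C : R, 0 <= C /\ forall N, (0 < N)%N ->
  `|psierr N| * ln N%:R ^+ 2 <=
  \sum_(1 <= n < N.+1) mangoldt2 n * `|psierr (N %/ n)| + C * N%:R * ln N%:R.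
Proof.
have [C [C0 hC]] := selberg_psierr R; exists (2 * C + 10); split; first lra.
have step N : (0 < N)%N -> `|psierr N| * ln N%:R <=
    \sum_(1 <= n < N.+1) mangoldt n * `|psierr (N %/ n)| + C * N%:R.
  move=> N0; have h := hC N N0.
  rewrite -[X in _ * X <= _](ger0_norm (lnn_ge0 R N)) -normrM.
  have E : psierr N * ln N%:R = (psierr N * ln N%:R
     + \sum_(1 <= n < N.+1) mangoldt n * psierr (N %/ n)) -
     \sum_(1 <= n < N.+1) mangoldt n * psierr (N %/ n) by ring.
  rewrite E; apply: (le_trans (ler_normB _ _)); rewrite addrC lerD//.
  apply: (le_trans (ler_norm_sum _ _ _)); apply: ler_sum => n _.
  by rewrite normrM ger0_norm ?mangoldt_ge0.
move=> N N0; have lN := lnn_ge0 R N.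
have h1 := ler_wpM2r lN (step N N0).
rewrite expr2 mulrA; apply: (le_trans h1).
(* For each n the error is (C + 10) floor(N / n): C from the second use of Selberg's formula, 10
   from [psierr_le] and the O(1) in log N. Summed against Lambda it gives log N!. *)
have h2 : (\sum_(1 <= n < N.+1) mangoldt n * `|psierr (N %/ n)|) * ln N%:R <=
   \sum_(1 <= n < N.+1) mangoldt2 n * `|psierr (N %/ n)| + (C + 10) * lnfact N.
  rewrite sum_mangoldt2 lnfact_mangoldt mulr_sumr mulr_suml -big_split/=.
  apply: ler_sum_nat => n /andP[n0 nN].
  have M0 : (0 < N %/ n)%N by rewrite divn_gt0.
  set M := (N %/ n)%N in M0 *.
  have hM := step M M0; have v0 := mangoldt_ge0 R n.
  have -> : \sum_(1 <= k < M.+1) mangoldt k * `|psierr (N %/ (n * k))| =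
      \sum_(1 <= k < M.+1) mangoldt k * `|psierr (M %/ k)|.
    by apply: eq_bigr => k _; rewrite divnMA.
  rewrite -mulrA [(C + 10) * _]mulrCA -mulrDr ler_wpM2l//.
  have lM : ln N%:R <= ln n%:R + ln M%:R + 1 :> R.
    have MR : 1 <= M%:R :> R by rewrite ler1n.
    have : ln N%:R <= ln (n%:R * (M%:R * 2)) :> R.
      have -> : n%:R * (M%:R * 2) = (n * (M * 2))%:R :> R by rewrite !natrM.
      apply: ler_lnn => //; apply: ltnW.
      apply: (leq_trans (ltn_ceil N n0)); rewrite -/M mulnC leq_pmul2l//.
      lia.
    rewrite !lnM ?posrE ?ltr0n ?mulr_gt0 ?ltr0n//.
    have := @ln_le_subr1 R 2; lra.
  have := ler_wpM2l (normr_ge0 (psierr M)) lM; have := psierr_le M; lra.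
have := lnfact_le_mul N => h3.
have := ler_wpM2l (_ : 0 <= C + 10) h3 => /(_ ltac:(lra)) h4.
lra.
Qed.

(** Partial summation: passing from N to N + 1 adds psi(N) (log (N+1) - log N) <= 10. *)
Lemma sum_mangoldt_ln_gap N :
  \sum_(1 <= n < N.+1) mangoldt n * (ln N%:R - ln n%:R) <= 10 * N%:R.
Proof.
elim: N => [|N IH]; first by rewrite big_geq// mulr0.
rewrite big_nat_recr//= subrr mulr0 addr0.
have -> : \sum_(1 <= n < N.+1) mangoldt n * (ln N.+1%:R - ln n%:R) =
   \sum_(1 <= n < N.+1) mangoldt n * (ln N%:R - ln n%:R)
   + psi N * (ln N.+1%:R - ln N%:R).
  rewrite mulr_suml -big_split/=; apply: eq_bigr => n _; ring.
case: N IH => [|N] IH.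
  by rewrite psi0 mul0r addr0 big_geq//; lra.
have := lnS_sub_le R (ltn0Sn N) => h.
have NR : 0 < N.+1%:R :> R by rewrite ltr0n.
have : psi N.+1 * (ln N.+2%:R - ln N.+1%:R) <= 10 * N.+1%:R * N.+1%:R^-1.
  by apply: ler_pM; rewrite ?psi_ge0 ?chebyshev_psi// subr_ge0 ler_lnn.
rewrite mulfK ?gt_eqF// -(natr1 N.+1); lra.
Qed.

Lemma sum_mangoldt2_bound : exists C : R, 0 <= C /\ forall N, (0 < N)%N ->
  `|\sum_(1 <= n < N.+1) mangoldt2 n - 2 * N%:R * ln N%:R| <= C * N%:R.
Proof.
have [C [C0 hC]] := selberg_psi; exists (C + 10); split; first lra.
move=> N N0.
have E : \sum_(1 <= n < N.+1) mangoldt2 n =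
   psi N * ln N%:R + \sum_(1 <= n < N.+1) mangoldt n * psi (N %/ n)
   - \sum_(1 <= n < N.+1) mangoldt n * (ln N%:R - ln n%:R).
  have := sum_mangoldt2 N (fun=> 1); under eq_bigr do rewrite mulr1.
  move=> ->; rewrite mulr_suml -big_split/= -sumrB; apply: eq_bigr => n _.
  by under eq_bigr do rewrite mulr1; rewrite -/(psi _); ring.
have := hC N N0; have := sum_mangoldt_ln_gap N.
have : 0 <= \sum_(1 <= n < N.+1) mangoldt n * (ln N%:R - ln n%:R).
  rewrite big_seq; apply: sumr_ge0 => n; rewrite mem_index_iota => /andP[n0 nN].
  by rewrite mulr_ge0 ?mangoldt_ge0// subr_ge0 ler_lnn.
rewrite E !ler_norml => a b /andP[c d].
have NR : 0 <= C * N%:R by rewrite mulr_ge0.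
by apply/andP; split; lra.
Qed.

(** [mertens] is used for the inner sum and then for the outer one. The leading coefficient 1 of
    (log N)^2 matters: it lets [eventual_bound_improve] turn any saving into a smaller constant. *)
Lemma sum_mangoldt2_div N : (0 < N)%N ->
  \sum_(1 <= n < N.+1) mangoldt2 n / n%:R <= (ln N%:R + 12) ^+ 2.
Proof.
move=> N0; have lN := lnn_ge0 R N.
rewrite (sum_mangoldt2 N (fun n => n%:R^-1)).
apply: (@le_trans _ _ (\sum_(1 <= n < N.+1) mangoldt n / n%:R * (ln N%:R + 12))).
  apply: ler_sum_nat => n /andP[n0 nN].
  have nR : 0 < n%:R :> R by rewrite ltr0n.
  have M0 : (0 < N %/ n)%N by rewrite divn_gt0.
  have -> : \sum_(1 <= k < (N %/ n).+1) mangoldt k / (n * k)%:R =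
      n%:R^-1 * mertens_sum R (N %/ n).
    by rewrite mulr_sumr; apply: eq_bigr => k _; rewrite natrM invfM; ring.
  rewrite -mulrA ler_wpM2l ?mangoldt_ge0// [ln n%:R * _]mulrC -mulrDr.
  rewrite ler_wpM2l ?invr_ge0//.
  have := mertens R M0; rewrite ler_norml => /andP[_ h].
  have : ln (N %/ n)%:R + ln n%:R <= ln N%:R :> R.
    rewrite -lnM ?posrE ?ltr0n// -natrM ler_lnn ?leq_trunc_div//.
    by rewrite muln_gt0 M0.
  lra.
rewrite -mulr_suml -/(mertens_sum R N) expr2 ler_wpM2r//; first lra.
have := mertens R N0; rewrite ler_norml => /andP[_ h]; lra.
Qed.

(** Abel summation turns the sum into a difference of [mertens_sum] and [harm], both log N + O(1).
    It keeps [psierr n] from being of order n with constant sign on long ranges. *)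
Lemma sum_psierr_bounded : exists A : R, forall N,
  `|\sum_(1 <= n < N.+1) psierr n / (n%:R * n.+1%:R)| <= A.
Proof.
have tel N : \sum_(1 <= n < N.+1) psierr n / (n%:R * n.+1%:R) =
    mertens_sum R N - psi N / N.+1%:R - (harm N.+1 - 1).
  elim: N => [|N IH].
    by rewrite !big_geq// /mertens_sum big_geq// psi0 harmS harm0 invr1; lra.
  have mS : mertens_sum R N.+1 = mertens_sum R N + mangoldt N.+1 / N.+1%:R.
    by rewrite /mertens_sum big_nat_recr.
  rewrite big_nat_recr//= IH mS (harmS _ N.+1) /psierr psiS.
  have a1 : N%:R + 1 != 0 :> R by rewrite natr1 pnatr_eq0.
  have a2 : N%:R + 1 + 1 != 0 :> R by rewrite !natr1 pnatr_eq0.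
  rewrite -(natr1 N.+1) -(natr1 N); field; by rewrite ?a1 ?a2.
exists 25 => -[|N]; first by rewrite big_geq// normr0.
rewrite tel; have := mertens R (ltn0Sn N).
have := ln_le_harm R N.+2; have := harm_le_ln R (ltn0Sn N.+1).
have := lnS_sub_le R (ltn0Sn N); have := lnS_sub_le R (ltn0Sn N.+1).
have p1 : 0 <= psi N.+1 / N.+2%:R by rewrite divr_ge0 ?psi_ge0.
have p2 : psi N.+1 / N.+2%:R <= 10.
  rewrite ler_pdivrMr ?ltr0n//; apply: (le_trans (chebyshev_psi _ _)).
  by rewrite ler_wpM2l// ler_nat.
have i1 : N.+1%:R^-1 <= 1 :> R by rewrite invf_le1 ?ltr0n// ler1n.
have i2 : N.+2%:R^-1 <= 1 :> R by rewrite invf_le1 ?ltr0n// ler1n.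
have l1 := @ler_lnn R N.+1 N.+2 isT (leqnSn _).
have l2 := @ler_lnn R N.+2 N.+3 isT (leqnSn _).
move: p1 p2 i1 i2; set P := psi N.+1 / _.
move=> p1 p2 i1 i2 a b c d; rewrite !ler_norml => /andP[e f].
by apply/andP; split; lrai.
Qed.

End SelbergConsequences.

(** * Intervals where psi is close to the identity *)

Section GoodIntervals.
Variable R : realType.
Implicit Types (n m N d k p q : nat).
Local Notation harm := (@harm R).
Local Notation psierr := (@psierr R).

Lemma nat_ge_real (B : R) :
  exists M, (0 < M)%N /\ forall n, (M <= n)%N -> B <= n%:R.
Proof.
exists (Num.truncn B).+1; split=> // n Mn.
by apply: (le_trans (ltW (truncnS_gt B))); rewrite ler_nat.
Qed.

Lemma ln_ge_real (B : R) :
  exists M, (0 < M)%N /\ forall n, (M <= n)%N -> B <= ln n%:R.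
Proof.
have [M [M0 hM]] := nat_ge_real (expR B); exists M; split => // n Mn.
rewrite -(expRK B) ler_ln ?posrE ?expR_gt0//; first exact: hM.
by rewrite ltr0n (leq_trans M0).
Qed.

Lemma ln_le_eps (e : R) : 0 < e ->
  exists M, (0 < M)%N /\ forall n, (M <= n)%N -> ln n%:R <= e * n%:R.
Proof.
move=> e0; have [M [M0 hM]] := nat_ge_real ((2 / e) ^+ 2).
exists M; split => // n Mn; have n0 : 0 < n%:R :> R by rewrite ltr0n (leq_trans M0).
apply: (le_trans (ln_le_2sqrt n0)).
have h : 2 / e <= Num.sqrt n%:R.
  have e2 : 0 <= 2 / e by rewrite divr_ge0// ltW.
  by rewrite -ler_sqr ?nnegrE ?sqrtr_ge0// sqr_sqrtr ?ler0n// hM.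
rewrite ler_pdivrMr// in h.
have s0 := sqrtr_ge0 (n%:R : R).
rewrite -[in leRHS](sqr_sqrtr (ltW n0)); nra.
Qed.

(** One step raises [psierr] by at most log (z + 1) and lowers it by at most 1, too little to jump
    across the strip of half-width e z. *)
Lemma psierr_steps (e : R) : 0 < e -> exists y0, (0 < y0)%N /\
  forall z, (y0 <= z)%N ->
  (psierr z < - (e * z%:R) -> psierr z.+1 < e * z.+1%:R) /\
  (e * z%:R < psierr z -> - (e * z.+1%:R) < psierr z.+1).
Proof.
move=> e0; have [M1 [M10 h1]] := nat_ge_real e^-1.
have [M2 [M20 h2]] := ln_le_eps e0.
exists (M1 + M2)%N; split; first by lia.
move=> z hz; have {}h1 := h1 z ltac:(lia); have {}h2 := h2 z.+1 ltac:(lia).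
have z1 : 1 <= e * z%:R by rewrite mulrC -ler_pdivrMr// mul1r.
have v := @mangoldt_le_ln R z.+1 isT; have v0 := mangoldt_ge0 R z.+1.
by rewrite /psierr psiS; move: h2 v; rewrite -(natr1 z) => h2 v; split; lra.
Qed.

(** Otherwise [psierr] keeps its sign on ]y, K y] by [psierr_steps], and the sum of psierr n / (n (n
    + 1)) over this range is at least about e log K in absolute value, against the bound 2 A. *)
Lemma good_point (e : R) : 0 < e -> exists K y0, [/\ (1 < K)%N, (0 < y0)%N &
  forall y, (y0 <= y)%N ->
    exists z, [/\ (y < z)%N, (z <= K * y)%N & `|psierr z| <= e * z%:R]].
Proof.
move=> e0; have [A hA] := sum_psierr_bounded R.
have [y0 [y00 hy0]] := psierr_steps e0.
(* The harmonic sum over the range is at least log K - 2; the third unit makes the contradiction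
   strict. *)
have [K0 [K00 hK0]] := ln_ge_real (2 * A / e + 3).
exists (K0 + 1)%N, y0; split; [lia|by []|].
set K := (K0 + 1)%N => y hy; apply: contrapT => hno.
have y0' : (0 < y)%N by lia.
have big z : (y < z)%N -> (z <= K * y)%N -> e * z%:R < `|psierr z|.
  by move=> yz zK; rewrite ltNge; apply/negP => h; apply: hno; exists z.
have yK : (y < K * y)%N by rewrite /K; lia.
(* [s] is the sign of [psierr] on the range, so that both signs are treated at once. *)
have key (s : R) : s = 1 \/ s = -1 -> e * y.+1%:R < s * psierr y.+1 -> False.
  move=> s1 sy.
  have pos j : (y.+1 + j <= K * y)%N -> e * (y.+1 + j)%:R < s * psierr (y.+1 + j).
    elim: j => [|j IH] hj; first by rewrite addn0.
    rewrite addnS; have {}IH := IH ltac:(lia).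
    have [c1 c2] := hy0 (y.+1 + j)%N ltac:(lia).
    have := big (y.+1 + j).+1 ltac:(lia) ltac:(lia).
    case: s1 IH => ->; rewrite ?mul1r ?mulN1r => IH.
      have {}c2 := c2 IH; case: (ger0P (psierr (y.+1 + j).+1)) => // h1 h2; lra.
    have {}c1 := c1 ltac:(lra).
    case: (ger0P (psierr (y.+1 + j).+1)) => // h1 h2; lra.
  have sumge : e * (harm (K * y).+1 - harm y.+1) <=
      s * \sum_(y.+1 <= z < (K * y).+1) psierr z / (z%:R * z.+1%:R).
    have -> : harm (K * y).+1 - harm y.+1 =
        \sum_(y.+1 <= z < (K * y).+1) z.+1%:R^-1.
      rewrite /harm (@big_cat_nat _ _ _ y.+2 _ (K * y).+2)//=; last by lia.
      by rewrite addrAC subrr add0r big_add1.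
    rewrite !mulr_sumr; apply: ler_sum_nat => z /andP[yz zK].
    have := pos (z - y.+1)%N; rewrite subnKC// => /(_ zK) /ltW h.
    have zR : 0 < z%:R :> R by rewrite ltr0n; lia.
    by rewrite invfM !mulrA ler_wpM2r ?invr_ge0// ler_pdivlMr.
  have := hA (K * y)%N; have := hA y.
  rewrite (@big_cat_nat _ _ _ y.+1 _ (K * y).+1)//=; last by lia.
  move: sumge; set S1 := \sum_(1 <= _ < _) _; set S2 := \sum_(y.+1 <= _ < _) _.
  move=> sumge; rewrite !ler_norml => /andP[a1 a2] /andP[b1 b2].
  have S2A : s * S2 <= 2 * A by case: s1 => ->; lra.
  have := ln_le_harm R (K * y).+1; have := harm_le_ln R (ltn0Sn y).
  have : ln (K * y)%:R <= ln (K * y).+2%:R :> R.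
    by apply: ler_lnn; rewrite ?(leq_trans _ yK)// ltnW.
  rewrite natrM lnM ?posrE ?ltr0n ?muln_gt0//; last by rewrite /K; lia.
  have : ln y.+1%:R <= ln (2 * y%:R) :> R.
    by rewrite -natrM ler_lnn// mul2n -addnn -addn1 leq_add2l.
  rewrite lnM ?posrE ?ltr0n//; have := @ln_le_subr1 R 2 ltac:(lra).
  have := hK0 K ltac:(rewrite /K; lia) => lK l2 ly lKy hy' hKy.
  have : e * (2 * A / e + 1) <= e * (harm (K * y).+1 - harm y.+1).
    by rewrite ler_wpM2l//; lra.
  rewrite mulrDr mulrCA divff ?gt_eqF//; lra.
have := big y.+1 (ltnSn y) yK.
case: (ger0P (psierr y.+1)) => h1 h2.
  by apply: (key 1); [left|rewrite mul1r].
by apply: (key (-1)); [right|rewrite mulN1r].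
Qed.

(** At the good point, |psierr z| <= (a/8) z. Up to (1 + 1/h) z with 1/h <= a/8, [psierr_increment]
    adds at most u - z <= (a/8) z and an error C z / log z <= (a/8) z. *)
Lemma good_interval (a : R) : 0 < a -> exists K h y0,
  [/\ (1 < K)%N, (0 < h)%N, (0 < y0)%N &
  forall y, (y0 <= y)%N -> exists z, [/\ (y < z)%N, (z <= K * y)%N &
    forall u, (z <= u)%N -> (u * h <= h.+1 * z)%N -> `|psierr u| <= a / 2 * u%:R]].
Proof.
move=> a0; have e0 : 0 < a / 8 by lra.
have [K [y1 [K1 y10 hgood]]] := good_point e0.
have [h [h0 hh]] := nat_ge_real (a / 8)^-1.
have {}hh := hh h (leqnn h).
have [C [C0 hC]] := psierr_increment R.
have [y2 [y20 hy2]] := ln_ge_real (C / (a / 8) + 1).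
exists K, h, (y1 + y2)%N; split => //; first lia.
move=> y hy; have [z [yz zK Rz]] := hgood y ltac:(lia).
exists z; split=> // u zu uh.
have z0 : (0 < z)%N by lia.
have zR : 0 < z%:R :> R by rewrite ltr0n.
have hR : 0 < h%:R :> R by rewrite ltr0n.
have u2 : (u <= 2 * z)%N.
  rewrite -(leq_pmul2r h0); apply: (leq_trans uh).
  by rewrite -mulnA [(z * h)%N]mulnC mulnA leq_mul2r; apply/orP; right; lia.
have := hC z u z0 zu u2; have lz := hy2 z ltac:(lia).
have zuR : z%:R <= u%:R :> R by rewrite ler_nat.
have uz8 : u%:R - z%:R <= a / 8 * z%:R.
  have : u%:R * h%:R <= h.+1%:R * z%:R :> R by rewrite -!natrM ler_nat.
  rewrite -natr1 mulrDl mul1r => hu.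
  have h8 : 1 <= a / 8 * h%:R by rewrite mulrC -ler_pdivrMr// mul1r.
  rewrite -(ler_pM2r hR).
  apply: (@le_trans _ _ (1 * z%:R)); first lra.
  apply: (@le_trans _ _ (a / 8 * h%:R * z%:R)); first by rewrite ler_wpM2r.
  by rewrite mulrAC.
have Cz : C <= a / 8 * ln z%:R.
  by rewrite mulrC -ler_pdivrMr//; lra.
have lz0 : 0 < ln z%:R :> R.
  by apply: lt_le_trans lz; rewrite ltr_wpDl// divr_ge0// ltW.
move=> inc.
have : `|psierr u - psierr z| <= (u%:R - z%:R) + a / 8 * z%:R.
  rewrite -(ler_pM2r lz0); apply: (le_trans inc).
  by rewrite [leRHS]mulrDl lerD2l mulrAC ler_wpM2r.
have := ler_normD (psierr u - psierr z) (psierr z); rewrite subrK => t1 t2.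
nra.
Qed.

End GoodIntervals.

(** * Improving the bound on |psi(N) - N| / N, and the prime number theorem for psi *)

Section PrimeNumberTheorem.
Variable R : realType.
Implicit Types (n m N d k p q : nat).
Local Notation psi := (@psi R).
Local Notation psierr := (@psierr R).
Local Notation mangoldt2 := (@mangoldt2 R).

Lemma ler_sum_subinterval (F : nat -> R) (a b c d : nat) :
  (forall n, 0 <= F n) -> (a <= b)%N -> (b <= c)%N -> (c <= d)%N ->
  \sum_(b <= n < c) F n <= \sum_(a <= n < d) F n.
Proof.
move=> F0 ab bc cd.
rewrite [leRHS](@big_cat_nat _ _ _ b)//=; last by rewrite (leq_trans bc).
rewrite [in leRHS](@big_cat_nat _ _ _ c b d)//= addrCA lerDl.
by rewrite addr_ge0// sumr_ge0.
Qed.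

(* The block ]p, q] consists of n with N / n in [z, (1 + 1/h) z]; the mean value
   2 log n of mangoldt2 bounds its weight from below. *)
Lemma good_block (h K : nat) : (0 < h)%N -> exists N0, (0 < N0)%N /\
  forall N y z, (N0 <= N)%N -> (0 < y)%N -> (y < z)%N -> (z <= K * y)%N ->
    (z * z <= N)%N ->
  exists p q, [/\ (N %/ (2 * K * y) <= p)%N, (p <= q)%N, (q <= N %/ y)%N,
   (forall n, (p < n)%N -> (n <= q)%N ->
      (z <= N %/ n)%N /\ ((N %/ n) * h <= h.+1 * z)%N) &
   ln N%:R / (16 * h%:R) <= \sum_(p.+1 <= n < q.+1) mangoldt2 n / n%:R :> R].
Proof.
move=> h0; have hR : 0 < h%:R :> R by rewrite ltr0n.
have [C [C0 hC]] := sum_mangoldt2_bound R.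
(* The term 32 h C keeps the error C (p + q) below half of the main term, which is at least q log N
   / (8 h); the 4 gives log N <= 4 log q. *)
have [M [M0 hM]] := ln_ge_real (32 * h%:R * C + 4).
exists (M + (2 * h + 1) * (2 * h + 1))%N; split; first lia.
move=> N y z hN y0 yz zK zzN.
have z0 : (0 < z)%N by lia.
have MN : (M <= N)%N by lia.
have hhN : ((2 * h).+1 * (2 * h).+1 <= N)%N by move: hN; clear; lia.
clear hN.
(* The end points solve N / n = z and N / n = (1 + 1/h) z. *)
pose q := (N %/ z)%N; pose p := (N * h %/ (h.+1 * z))%N.
have hz0 : (0 < h.+1 * z)%N by rewrite muln_gt0.
have p1 : (p * (h.+1 * z) <= N * h)%N by exact: leq_trunc_div.
have p2 : (N * h < p.+1 * (h.+1 * z))%N by exact: ltn_ceil.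
have q1 : (q * z <= N)%N by exact: leq_trunc_div.
have q2 : (N < q.+1 * z)%N by exact: ltn_ceil.
have qN : (N < q.+1 * q.+1)%N.
  have : (z < q.+1)%N by rewrite -(ltn_pmul2r z0) (leq_ltn_trans zzN).
  by move=> zq; apply: (leq_trans q2); rewrite leq_mul2l ltnW ?orbT.
have q2h : (2 * h <= q)%N.
  rewrite -ltnS ltnNge; apply/negP => hq.
  have := leq_trans (leq_mul (leqW hq) (leqW hq)) hhN.
  by rewrite leqNgt qN.
have pq : (p * h.+1 < q.+1 * h)%N.
  rewrite -(ltn_pmul2r z0) -mulnA; apply: (leq_ltn_trans p1).
  by rewrite mulnAC ltn_pmul2r.
have pleq : (p <= q)%N.
  rewrite leqNgt; apply/negP => hq.
  by move: pq; rewrite ltnNge leq_mul.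
have q0 : (0 < q)%N by rewrite (leq_trans _ q2h)// muln_gt0.
exists p, q; split => //.
- have zh : (h.+1 * z <= (2 * K * y) * h)%N.
    have -> : (2 * K * y * h = (2 * h) * (K * y))%N by clear; lia.
    by rewrite leq_mul// mul2n -addnn -addn1 leq_add2l.
  rewrite -ltnS -(ltn_pmul2r hz0); apply: leq_ltn_trans p2.
  apply: (@leq_trans (N %/ (2 * K * y) * (2 * K * y * h))).
    by rewrite leq_mul2l zh orbT.
  by rewrite mulnA leq_mul2r leq_trunc_div orbT.
- by rewrite leq_div2l// ltnW.
- move=> n pn nq; have n0 : (0 < n)%N by rewrite (leq_trans _ pn).
  split; first by rewrite leq_divRL// (leq_trans _ q1)// mulnC leq_mul2r nq orbT.
  have mn := leq_trunc_div N n; set m := (N %/ n)%N in mn *.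
  rewrite -(leq_pmul2r n0) mulnAC.
  apply: (@leq_trans (N * h)); first by rewrite leq_mul2r mn orbT.
  apply: ltnW; apply: (leq_trans p2).
  by rewrite mulnC leq_mul2l pn orbT.
have qR : 0 < q%:R :> R by rewrite ltr0n.
have Ps (n : nat) :
    2 * n%:R * ln n%:R - C * n%:R <= \sum_(1 <= i < n.+1) mangoldt2 i
    <= 2 * n%:R * ln n%:R + C * n%:R.
  case: n => [|n]; first by rewrite big_geq//; apply/andP; split; lra.
  have := hC n.+1 isT; rewrite ler_norml => /andP[? ?].
  by apply/andP; split; lra.
have /andP[s1 _] := Ps q; have /andP[_ s2] := Ps p.
have S : \sum_(p.+1 <= n < q.+1) mangoldt2 n =
   \sum_(1 <= n < q.+1) mangoldt2 n - \sum_(1 <= n < p.+1) mangoldt2 n.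
  by rewrite (@big_cat_nat _ _ _ p.+1 1 q.+1)//= addrAC subrr add0r.
have lqp : p%:R * ln p%:R <= p%:R * ln q%:R :> R.
  case: (posnP p) => [->|pp]; first by rewrite !mul0r.
  by rewrite ler_wpM2l// ler_lnn.
have pqR : p%:R <= q%:R :> R by rewrite ler_nat.
(* From p (h + 1) <= (q + 1) h, q - p >= (q - h) / (h + 1), and q >= 2 h. *)
have gap : q%:R <= 4 * h%:R * (q%:R - p%:R) :> R.
  have pqR' : p%:R * (h%:R + 1) <= (q%:R + 1) * h%:R :> R.
    by rewrite !natr1 -!natrM ler_nat ltnW.
  have : 2 * h%:R <= q%:R :> R by rewrite -natrM ler_nat.
  have : 1 <= h%:R :> R by rewrite ler1n.
  nra.
have lnq : ln N%:R <= 4 * ln q%:R :> R.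
  have := hM N MN; have hC0 : 0 <= h%:R * C by rewrite mulr_ge0// ltW.
  have : ln N%:R <= ln (q.+1 * q.+1)%:R :> R.
    by apply: ler_lnn; [exact: leq_trans M0 MN|exact: ltnW].
  rewrite natrM lnM ?posrE ?ltr0n//.
  have : ln q.+1%:R <= ln (2 * q%:R) :> R.
    by rewrite -natrM ler_lnn// mul2n -addnn -addn1 leq_add2l.
  rewrite lnM ?posrE//; have := @ln_le_subr1 R 2 ltac:(lra); lra.
have lnN := hM N MN.
apply: (@le_trans _ _ (\sum_(p.+1 <= n < q.+1) mangoldt2 n / q%:R)); last first.
  apply: ler_sum_nat => n /andP[pn nq]; rewrite ler_wpM2l ?mangoldt2_ge0//.
  by rewrite lef_pV2 ?posrE ?ltr0n ?ler_nat// (leq_trans _ pn).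
rewrite -mulr_suml S ler_pdivlMr// -mulrA [_^-1 * _]mulrC mulrA.
rewrite ler_pdivrMr; last by rewrite mulr_gt0.
have lnq0 := lnn_ge0 R q.
have g1 := ler_wpM2r lnq0 gap.
have g2 : q%:R * ln N%:R <= q%:R * (4 * ln q%:R) :> R by rewrite ler_wpM2l// ltW.
have g3 : q%:R * (32 * h%:R * C + 4) <= q%:R * ln N%:R :> R.
  by rewrite ler_wpM2l// ltW.
have g4 : h%:R * C * p%:R <= h%:R * C * q%:R by rewrite ler_wpM2l// mulr_ge0// ltW.
have D : 2 * (q%:R - p%:R) * ln q%:R - C * q%:R - C * p%:R <=
  \sum_(1 <= i < q.+1) mangoldt2 i - \sum_(1 <= i < p.+1) mangoldt2 i by lra.
have D' := ler_wpM2r (ltW hR) D.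
lra.
Qed.

(** The scales y = y0 B^j with y^2 <= N are of order log N in number, and each yields a block of
    weight at least log N / (16 h) by [good_block]. *)
Lemma good_mass (a : R) : 0 < a -> exists (c : R) N0, 0 < c /\
  forall N, (N0 <= N)%N -> c * ln N%:R ^+ 2 <=
   \sum_(1 <= n < N.+1)
     if `|psierr (N %/ n)| <= a / 2 * (N %/ n)%:R then mangoldt2 n / n%:R else 0.
Proof.
move=> a0; have [K [h [y0 [K1 h0 y00 hgood]]]] := good_interval a0.
have [N1 [N10 hblock]] := good_block K h0.
have hR : 0 < h%:R :> R by rewrite ltr0n.
pose B := (2 * K)%N; have B0 : (0 < B)%N by rewrite /B; lia.
have lB : 0 < ln B%:R :> R by rewrite ln_gt0// ltr1n /B; lia.
have [N2 [N20 hN2]] := ln_ge_real (8 * ln B%:R + 4 * ln y0%:R : R).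
exists ((8 * ln B%:R)^-1 * (16 * h%:R)^-1), (N1 + N2)%N; split.
  by rewrite mulr_gt0// invr_gt0 mulr_gt0.
move=> N hN.
pose F n :=
  if `|psierr (N %/ n)| <= a / 2 * (N %/ n)%:R then mangoldt2 n / n%:R else 0.
rewrite [leRHS](_ : _ = \sum_(1 <= n < N.+1) F n)//.
have F0 n : 0 <= F n.
  by rewrite /F; case: ifP => // _; rewrite divr_ge0 ?mangoldt2_ge0.
have N0 : (0 < N)%N by lia.
(* Since B = 2 K, the j-th block lies in ]x (j + 1), x j]; hence the blocks are disjoint. *)
pose x j := (N %/ (y0 * B ^ j))%N.
have claim J : ((y0 * B ^ J) * (y0 * B ^ J) <= N)%N ->
   (x J <= x 0%N)%N /\
   J%:R * (ln N%:R / (16 * h%:R)) <= \sum_((x J).+1 <= n < (x 0%N).+1) F n.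
  elim: J => [|J IH] hJ; first by rewrite mul0r big_geq.
  set y := (y0 * B ^ J)%N in IH *.
  have Sy : (y0 * B ^ J.+1 = B * y)%N by rewrite expnS mulnCA.
  have yy : (y <= B * y)%N by rewrite leq_pmull.
  have y_gt0 : (0 < y)%N by rewrite muln_gt0 y00 expn_gt0 B0.
  rewrite Sy in hJ.
  have [xJ0 {}IH] := IH (leq_trans (leq_mul yy yy) hJ).
  have y0y : (y0 <= y)%N by rewrite leq_pmulr// expn_gt0 B0.
  have [z [yz zK zgood]] := hgood y y0y.
  have zB : (z <= B * y)%N.
    by rewrite (leq_trans zK)// leq_mul2r /B; apply/orP; right; lia.
  have [p [q [xp pq qx pqgood sumge]]] :=
    hblock N y z ltac:(lia) y_gt0 yz zK (leq_trans (leq_mul zB zB) hJ).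
  have xJ : (x J.+1 <= p)%N by rewrite /x Sy.
  have xx : (x J.+1 <= x J)%N by rewrite (leq_trans xJ)// (leq_trans pq).
  split; first by rewrite (leq_trans xx).
  rewrite (@big_cat_nat _ _ _ (x J).+1)//= -natr1 mulrDl mul1r addrC lerD//.
  apply: (le_trans sumge).
  apply: (@le_trans _ _ (\sum_(p.+1 <= n < q.+1) F n)); last first.
    exact: ler_sum_subinterval.
  apply: ler_sum_nat => n /andP[pn nq].
  have [zn nh] := pqgood n pn nq.
  by rewrite /F zgood.
(* Then 2 J log B <= (log N) / 2, and log N >= 4 log y0 leaves (y0 B^J)^2 <= N; log N >= 8 log B
   gives J >= log N / (8 log B). *)
pose J := Num.truncn (ln N%:R / (4 * ln B%:R) : R).
have l4B : 0 < 4 * ln B%:R :> R by lra.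
have J1 : J%:R * (4 * ln B%:R) <= ln N%:R :> R.
  by rewrite -ler_pdivlMr// truncn_le// divr_ge0 ?lnn_ge0// ltW.
have J2 : ln N%:R < (J%:R + 1) * (4 * ln B%:R) :> R.
  by rewrite -ltr_pdivrMr// natr1 truncnS_gt.
have lN := hN2 N ltac:(lia); have ly0 := lnn_ge0 R y0.
have hJ : ((y0 * B ^ J) * (y0 * B ^ J) <= N)%N.
  have yR : 0 < (y0 * B ^ J)%:R :> R by rewrite ltr0n muln_gt0 y00 expn_gt0 B0.
  rewrite -(ler_nat R) -ler_ln ?posrE ?natrM ?mulr_gt0 ?ltr0n ?expn_gt0 ?B0//.
  rewrite !lnM ?posrE ?mulr_gt0 ?ltr0n ?expn_gt0 ?B0// natrX lnXn ?ltr0n//.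
  rewrite -[ln B%:R *+ J]mulr_natl; by move: lB J1 lN ly0; clear; lra.
have [_ cl] := claim J hJ.
apply: (@le_trans _ _ (\sum_((x J).+1 <= n < (x 0%N).+1) F n)); last first.
  case: (leqP (x J) (x 0%N)) => xJ0; last first.
    by rewrite big_geq ?sumr_ge0// ltnS ltnW.
  by apply: ler_sum_subinterval => //; rewrite ltnS leq_div.
apply: le_trans cl.
have lN0 := lnn_ge0 R N.
have -> : (8 * ln B%:R)^-1 * (16 * h%:R)^-1 * ln N%:R ^+ 2 =
   (ln N%:R / (8 * ln B%:R)) * (ln N%:R / (16 * h%:R)) :> R by ring.
rewrite ler_wpM2r//; first by rewrite divr_ge0// mulr_ge0// ltW.
rewrite ler_pdivrMr; lra.
Qed.

(** In [psierr_ln2_le], |psierr m| is at most al m for m >= M0 and 10 M0 below. On the n of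
    [good_mass] the factor a/2 <= al - a/2 replaces al, which saves (a c0 / 2) N (log N)^2; half of
    it absorbs the lower-order terms. The gain c depends on a but not on al. *)
Lemma eventual_bound_improve (a : R) : 0 < a -> exists2 c : R, 0 < c &
  forall al : R, a <= al ->
  (exists M0, forall m, (M0 <= m)%N -> `|psierr m| <= al * m%:R) ->
  exists M1, forall m, (M1 <= m)%N -> `|psierr m| <= (al - c) * m%:R.
Proof.
move=> a0; have [c0 [N0 [c00 hmass]]] := good_mass a0.
exists (a * c0 / 4); first by rewrite divr_gt0// mulr_gt0.
move=> al aal [M0 hM0].
have [C1 [C10 hln2]] := psierr_ln2_le R.
have [C2 [C20 hsum]] := sum_mangoldt2_bound R.
set c := a * c0 / 4; have c_gt0 : 0 < c by rewrite /c divr_gt0// mulr_gt0.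
(* With L = log N, [D1] and [D2] collect the coefficients of N L and N: al (L + 12)^2 gives 24 al
   and 144 al, the values below M0 give 10 M0 (2 L + C2). *)
set D1 := 24 * al + 20 * M0%:R + C1.
set D2 := 144 * al + 10 * M0%:R * C2.
have D20 : 0 <= D2 by rewrite /D2 addr_ge0// ?mulr_ge0//; lra.
have [N1 [N10 hN1]] := ln_ge_real ((D1 + D2) / c + 1).
exists (N0 + N1)%N => N hN.
have Npos : (0 < N)%N by lia.
have NR : 0 < N%:R :> R by rewrite ltr0n.
have := hmass N ltac:(lia); set G := \sum_(1 <= n < N.+1) _ => hG.
set L := ln N%:R in hG.
have L0 : 0 <= L by exact: lnn_ge0.
have hL : (D1 + D2) / c + 1 <= L by apply: hN1; rewrite (leq_trans _ hN)// leq_addl.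
have S : \sum_(1 <= n < N.+1) mangoldt2 n * `|psierr (N %/ n)| <=
   N%:R * (al * (\sum_(1 <= n < N.+1) mangoldt2 n / n%:R) - a / 2 * G)
   + 10 * M0%:R * \sum_(1 <= n < N.+1) mangoldt2 n.
  rewrite /G 2![_ * (\sum_(1 <= n < N.+1) _)]mulr_sumr -sumrB.
  rewrite [10 * M0%:R * _]mulr_sumr mulr_sumr -big_split/=.
  apply: ler_sum_nat => n /andP[n0 nN].
  have nR : 0 < n%:R :> R by rewrite ltr0n.
  have v0 := mangoldt2_ge0 R n.
  have /andP[_ Mn] := floor_div_bounds R N n0.
  set M := (N %/ n)%N in Mn *.
  have Nn0 : 0 <= N%:R / n%:R :> R by rewrite divr_ge0.
  have M00 : 0 <= 10 * M0%:R :> R by rewrite mulr_ge0.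
  have -> : forall t : R, N%:R * (al * (mangoldt2 n / n%:R) - a / 2 * t) +
     10 * M0%:R * mangoldt2 n = mangoldt2 n * (al * (N%:R / n%:R) + 10 * M0%:R)
     - a / 2 * N%:R * t by move=> t; ring.
  case: ifP => hg.
    have -> : mangoldt2 n * (al * (N%:R / n%:R) + 10 * M0%:R) -
      a / 2 * N%:R * (mangoldt2 n / n%:R) =
      mangoldt2 n * ((al - a / 2) * (N%:R / n%:R) + 10 * M0%:R) by ring.
    rewrite ler_wpM2l//; apply: (le_trans hg).
    have : a / 2 * M%:R <= a / 2 * (N%:R / n%:R) by rewrite ler_wpM2l//; lra.
    have : (a / 2) * (N%:R / n%:R) <= (al - a / 2) * (N%:R / n%:R).
      by rewrite ler_wpM2r//; lra.
    lra.
  rewrite mulr0 subr0 ler_wpM2l//.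
  case: (leqP M0 M) => hM.
    have := hM0 M hM.
    have : al * M%:R <= al * (N%:R / n%:R) by rewrite ler_wpM2l//; lra.
    lra.
  have := psierr_le R M.
  have : M%:R <= M0%:R :> R by rewrite ler_nat ltnW.
  have : 0 <= al * (N%:R / n%:R) by rewrite mulr_ge0//; lra.
  lra.
have h1 := hln2 N Npos.
have := hsum N Npos; rewrite -/L ler_norml => /andP[_ h2].
have h3 := sum_mangoldt2_div R Npos; rewrite -/L in h1 h3.
set W := \sum_(1 <= n < N.+1) mangoldt2 n / n%:R in S h3.
set P2 := \sum_(1 <= n < N.+1) mangoldt2 n in S h2.
have L1 : 1 <= L.
  apply: le_trans hL; rewrite lerDr divr_ge0 ?(ltW c_gt0)//.
  by rewrite addr_ge0// /D1 !addr_ge0// mulr_ge0//; lra.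
have k1 : al * W <= al * (L + 12) ^+ 2 by rewrite ler_wpM2l//; lra.
have k2 : a / 2 * (c0 * L ^+ 2) <= a / 2 * G by rewrite ler_wpM2l//; lra.
have k3 : N%:R * (al * W - a / 2 * G) <=
     N%:R * (al * (L + 12) ^+ 2 - a / 2 * (c0 * L ^+ 2)).
  by rewrite ler_wpM2l//; lra.
have k4 : 10 * M0%:R * P2 <= 10 * M0%:R * (2 * N%:R * L + C2 * N%:R).
  by rewrite ler_wpM2l// ?mulr_ge0//; lra.
have k5 : D1 * L + D2 <= c * L ^+ 2.
  have : D1 + D2 <= c * L by rewrite mulrC -ler_pdivrMr//; lra.
  have : D2 <= D2 * L by rewrite ler_peMr.
  rewrite expr2 mulrA => i1 i2; have := ler_wpM2r L0 i2; lra.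
have k6 := ler_wpM2l (ltW NR) k5.
have L2 : 0 < L ^+ 2 by rewrite exprn_gt0//; lra.
rewrite -(ler_pM2r L2); apply: (le_trans h1).
move: k6; rewrite /D1 /D2 /c; lra.
Qed.

(** If the infimum of the admissible constants were positive, [eventual_bound_improve] with a equal
    to it would carry a constant less than c above it to one below it. *)
Lemma psi_asymp (e : R) : 0 < e ->
  exists M, (0 < M)%N /\ forall m, (M <= m)%N -> `|psi m - m%:R| <= e * m%:R.
Proof.
move=> e0.
pose E : set R :=
  [set al | exists M0, forall m, (M0 <= m)%N -> `|psierr m| <= al * m%:R].
have E10 : E 10 by exists 0%N => m _; exact: psierr_le.
have El al : E al -> 0 <= al.
  move=> [M0 hM0]; have := hM0 M0.+1 (leqnSn _) => h.
  have := le_trans (normr_ge0 _) h.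
  by rewrite pmulr_lge0// ltr0n.
have hinf : has_inf E by split; [exists 10|exists 0 => al /El].
have inf0 : 0 <= inf E by apply: lb_le_inf; [exists 10|move=> al /El].
have : inf E = 0.
  apply/eqP; rewrite eq_le inf0 andbT leNgt; apply/negP => ipos.
  have [c c0 himp] := eventual_bound_improve ipos.
  have [al Eal alc] := inf_adherent c0 hinf.
  have ial : inf E <= al by apply: ge_inf => //; case: hinf.
  have : E (al - c) by exact: himp.
  move=> /(ge_inf hinf.2); lra.
move=> i0; have [al [M0 hM0] alc] := inf_adherent e0 hinf.
exists M0.+1; split=> // m hm; apply: (le_trans (hM0 m (ltnW hm))).
by rewrite ler_wpM2r//; move: alc; rewrite i0; lra.
Qed.

End PrimeNumberTheorem.

(** * The n-th prime *)

(** The least m at which the count reaches k is a witness, so [xget] does not return its default. *)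
Lemma kth_natP (P : pred nat) (k : nat) :
  (forall m, exists2 n, (m <= n)%N & P n) -> (0 < k)%N ->
  P (kth_nat P k) /\ count P (iota 0 (kth_nat P k).+1) = k.
Proof.
move=> infP k0.
have iotaS n : count P (iota 0 n.+1) = (count P (iota 0 n) + P n)%N.
  by rewrite -addn1 iotaD count_cat/= add0n addn0.
have unb : exists N, (k <= count P (iota 0 N.+1))%N.
  elim: {k0} k => [|k [N kN]]; first by exists 0%N.
  have [n Nn Pn] := infP N.+1; exists n; rewrite iotaS Pn addn1 ltnS.
  by rewrite (leq_trans kN)// -(subnKC Nn) iotaD count_cat leq_addr.
suff ex : exists m, P m /\ count P (iota 0 m.+1) = k.
  exact: (@xgetPex _ 0%N [set m : nat | P m /\ count P (iota 0 m.+1) = k] ex).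
case: (ex_minnP unb) => m km mmin; exists m.
have lt : (count P (iota 0 m) < k)%N.
  case: m {km} mmin => [_|m mmin]; first by rewrite k0.
  by rewrite ltnNge; apply/negP => /mmin; rewrite ltnn.
move: km; rewrite iotaS; case: (P m) => km; last by lia.
by split => //; lia.
Qed.

Lemma nth_primeP i : (0 < i)%N ->
  prime (nth_prime i) /\ count prime (iota 0 (nth_prime i).+1) = i.
Proof.
apply: kth_natP => m; have [p mp pp] := prime_above m.
by exists p => //; exact: ltnW.
Qed.

Lemma count_iota_mono (P : pred nat) m n : (m <= n)%N ->
  (count P (iota 0 m) <= count P (iota 0 n))%N.
Proof. by move=> mn; rewrite -(subnKC mn) iotaD count_cat leq_addr. Qed.

Lemma nth_prime_lt i j : (0 < i)%N -> (i < j)%N -> (nth_prime i < nth_prime j)%N.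
Proof.
move=> i0 ij; have [_ ci] := nth_primeP i0.
have [_ cj] := nth_primeP (ltn_trans i0 ij).
rewrite ltnNge; apply/negP => ji; move: ij; rewrite -{1}ci -cj ltnNge.
by rewrite count_iota_mono.
Qed.

Lemma count_prime_le N : (count prime (iota 0 N.+1) <= N)%N.
Proof.
by rewrite /= add0n (leq_trans (count_size _ _))// size_iota.
Qed.

Lemma leq_nth_prime i : (i <= nth_prime i)%N.
Proof.
case: i => // i; have [_ {1}<-] := nth_primeP (ltn0Sn i).
exact: count_prime_le.
Qed.

(** * From psi to the size of the n-th prime *)

Section PrimeCounting.
Variable R : realType.
Implicit Types (n m N d k p q : nat).
Local Notation mangoldt := (@mangoldt R).
Local Notation psi := (@psi R).

Lemma mangoldt_prime_ge p : prime p -> ln p%:R <= mangoldt p.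
Proof.
move=> pp; have p1 := prime_gt1 pp.
rewrite /mangoldt big_mkcond (bigD1_seq p)/= ?iota_uniq//; last first.
  by rewrite mem_index_iota prime_gt0/=.
rewrite pp ler_wpDr//.
  apply: sumr_ge0 => q _; case: ifP => // _.
  by apply: sumr_ge0 => k _; exact: lnn_ge0.
rewrite big_mkcond big_ltn ?ltnS ?prime_gt0// expn1 eqxx ler_wpDr//.
by apply: sumr_ge0 => k _; case: ifP => // _; exact: lnn_ge0.
Qed.

Lemma sum_prime_const (c : R) m N :
  \sum_(m <= p < N | prime p) c = (count prime (index_iota m N))%:R * c.
Proof. by rewrite big_const_seq iter_addr_0 mulr_natl. Qed.

(** A prime p contributes log p once for each k with p^k <= N, in total the logarithm of a power of
    p that is at most N. *)
Lemma psi_le_count N :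
  psi N <= (count prime (iota 0 N.+1))%:R * ln N%:R.
Proof.
case: (posnP N) => [->|N0]; first by rewrite psi0 ln0// mulr0.
have -> : count prime (iota 0 N.+1) = count prime (index_iota 1 N.+1).
  by rewrite /= /index_iota subSS subn0.
rewrite -sum_prime_const.
have -> : psi N = \sum_(1 <= n < N.+1) \sum_(1 <= p < N.+1 | prime p)
   \sum_(1 <= k < N.+1) if n == (p ^ k)%N then ln p%:R else 0 : R.
  rewrite /psi; apply: eq_big_nat => n /andP[_ nN].
  rewrite (@mangoldt_widen _ n N)//; apply: eq_bigr => p _; exact: big_mkcond.
rewrite exchange_big/=; apply: ler_sum => p pp; rewrite exchange_big/=.
have p1 := prime_gt1 pp; have p0 := prime_gt0 pp.
have lN : (trunc_log p N <= N)%N.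
  apply: ltnW; rewrite -(ltn_exp2l _ _ p1).
  by rewrite (leq_ltn_trans (trunc_logP p1 N0))// ltn_expl.
have -> : \sum_(1 <= k < N.+1) \sum_(1 <= n < N.+1)
     (if n == (p ^ k)%N then ln p%:R else 0)
   = \sum_(1 <= k < (trunc_log p N).+1) ln p%:R :> R.
  rewrite [RHS](big_nat_widen _ _ N.+1)// [RHS]big_mkcond/=.
  apply: eq_bigr => k _; rewrite -big_mkcond big_nat1_eq expn_gt0 p0/= ltnS.
  rewrite ltnS; case: (leqP k (trunc_log p N)) => kN.
    by rewrite ifT// (leq_trans _ (trunc_logP p1 N0))// leq_exp2l.
  rewrite ifF//; apply/negP => pk; move: kN.
  by rewrite ltnNge trunc_log_max.
rewrite sumr_const_nat subn1/= -lnXn ?ltr0n// -natrX ler_lnn ?trunc_logP//.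
by rewrite expn_gt0 p0.
Qed.

(** Only the primes in ]M, N] are kept; at most M are lost, and each of the others weighs at least
    log M. *)
Lemma psi_ge_count N M : (0 < M)%N -> (M <= N)%N ->
  ((count prime (iota 0 N.+1))%:R - M%:R) * ln M%:R <= psi N.
Proof.
move=> M0 MN; set c := count _ _.
rewrite /psi (@big_cat_nat _ _ _ M.+1)//= ler_wpDl//.
  by apply: sumr_ge0 => n _; exact: mangoldt_ge0.
apply: (@le_trans _ _ (\sum_(M.+1 <= p < N.+1 | prime p) ln M%:R)).
  rewrite sum_prime_const ler_wpM2r ?lnn_ge0// lerBlDl -natrD ler_nat.
  rewrite /c; have -> : iota 0 N.+1 = iota 0 M.+1 ++ index_iota M.+1 N.+1.
    by rewrite /index_iota -iotaD subnKC.
  by rewrite count_cat leq_add2r count_prime_le.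
rewrite big_mkcond; apply: ler_sum_nat => p /andP[Mp pN].
case: ifP => [pp|_]; last exact: mangoldt_ge0.
by apply: le_trans (mangoldt_prime_ge pp); apply: ler_lnn => //; exact: ltnW.
Qed.

(** For p = p_n, p / 2 <= psi(p) <= n log p, so log p <= log n + log log p + log 2, where log log p
    <= d log p and log 2 <= d log n. *)
Lemma ln_nth_prime_le (d : R) : 0 < d -> d <= 8^-1 ->
  exists N0, forall n, (N0 <= n)%N ->
  (1 - d) * ln (nth_prime n)%:R <= (1 + d) * ln n%:R.
Proof.
move=> d0 d8; have h2 : 0 < 2^-1 :> R by lra.
have [M1 [M10 hpsi]] := psi_asymp h2.
have [M2 [M20 hln]] := ln_ge_real ((2 / d) ^+ 2 : R).
have [M3 [M30 hln']] := ln_ge_real (1 / d : R).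
exists (M1 + M2 + M3)%N => n hn; have n0 : (0 < n)%N by lia.
have np := leq_nth_prime n; have [pp cp] := nth_primeP n0.
set p := nth_prime n in np pp cp *.
have p0 := prime_gt0 pp.
have := psi_le_count p; rewrite cp.
have := hpsi p ltac:(lia); have := hln p ltac:(lia); have := hln' n ltac:(lia).
have pR : 0 < p%:R :> R by rewrite ltr0n.
have nR : 0 < n%:R :> R by rewrite ltr0n.
set L := ln p%:R => l1 l2; rewrite ler_norml => /andP[b1 b2] b3.
have e2 : 0 < 2 / d by rewrite divr_gt0.
have L0 : 0 < L by apply: lt_le_trans l2; rewrite exprn_gt0.
have plt : p%:R <= 2 * (n%:R * L) by lra.
have : ln p%:R <= ln (2 * (n%:R * L)).
  by rewrite ler_ln ?posrE ?mulr_gt0.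
rewrite !lnM ?posrE ?mulr_gt0// -/L.
have lnL : ln L <= d * L.
  apply: (le_trans (ln_le_2sqrt L0)).
  have h : 2 / d <= Num.sqrt L.
    by rewrite -ler_sqr ?nnegrE ?sqrtr_ge0 ?(ltW e2)// sqr_sqrtr// ltW.
  rewrite ler_pdivrMr// in h.
  have s0 := sqrtr_ge0 L.
  rewrite -[in leRHS](sqr_sqrtr (ltW L0)); nra.
have := @ln_le_subr1 R 2 ltac:(lra).
move: l1; rewrite ler_pdivrMr// => l1; lra.
Qed.

(** For d <= 1/8, (1 + d) / (1 - d)^2 <= 1 + 8 d and (1 - d)^2 / (1 + d) >= 1 - 8 d. *)
Lemma ratio_bound (d e X p : R) : 0 < d -> d <= 8^-1 -> 8 * d <= e ->
  0 <= X -> 0 <= p -> (1 - d) * ((1 - d) * p) <= (1 + d) * X ->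
  (1 - d) * ((1 - d) * X) <= (1 + d) * p -> `|p - X| <= e * X.
Proof.
move=> d0 d8 de X0 p0 up lo.
have eX : 8 * d * X <= e * X by rewrite ler_wpM2r.
have dX : 0 <= d * X by rewrite mulr_ge0// ltW.
have dX8 : d * X <= 8^-1 * X by rewrite ler_wpM2r.
have ddX : d * (d * X) <= 8^-1 * (d * X) by rewrite ler_wpM2r.
have dp : d * p <= 8^-1 * p by rewrite ler_wpM2r.
have ddp0 : 0 <= d * (d * p) by rewrite !mulr_ge0// ltW.
have ddX0 : 0 <= d * (d * X) by rewrite !mulr_ge0// ltW.
have dddX0 : 0 <= d * (d * (d * X)) by rewrite !mulr_ge0// ltW.
have k1 : 0 < (1 - d) * (1 - d) by rewrite mulr_gt0//; lra.
have k2 : 0 < 1 + d by lra.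
have pX : p <= (1 + 8 * d) * X by rewrite -(ler_pM2l k1); lra.
have Xp : (1 - 8 * d) * X <= p by rewrite -(ler_pM2l k2); lra.
by rewrite ler_norml; apply/andP; split; lra.
Qed.

(** Above: (1 - d) p <= psi(p) <= n log p and [ln_nth_prime_le]. Below: [psi_ge_count] with M =
    floor(n / h), where M <= d n and log M >= (1 - d) log n. *)
Lemma nth_prime_asymp (e : R) : 0 < e ->
  exists N0, forall n, (N0 <= n)%N ->
  `|(nth_prime n)%:R - n%:R * ln n%:R| <= e * (n%:R * ln n%:R).
Proof.
move=> e0; pose d := Num.min (e / 8) 8^-1.
have d0 : 0 < d by rewrite lt_min; apply/andP; split; lra.
have d8 : d <= 8^-1 by rewrite ge_min lexx orbT.
have de : 8 * d <= e.
  have : d <= e / 8 by rewrite ge_min lexx.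
  lra.
have [N1 h1] := ln_nth_prime_le d0 d8.
have [N2 [N20 h2]] := psi_asymp d0.
have [h [h0 hh]] := nat_ge_real (2 / d).
have {}hh := hh h (leqnn h).
have [N3 [N30 h3]] := ln_ge_real (ln (2 * h%:R) / d : R).
exists (N1 + N2 + N3 + 2 * h)%N => n hn; have n0 : (0 < n)%N by lia.
have [nN1 nN2 nN3 hn2 nh] :
    [/\ (N1 <= n)%N, (N2 <= n)%N, (N3 <= n)%N, (2 * h <= n)%N & (h <= n)%N].
  by split; lia.
have np := leq_nth_prime n; have [pp cp] := nth_primeP n0.
have {}h1 := h1 n nN1; have {}h2 := h2 (nth_prime n) (leq_trans nN2 np).
have {}h3 := h3 n nN3.
set p := nth_prime n in np pp cp h1 h2 *.
have p0 := prime_gt0 pp.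
have u := psi_le_count p; rewrite cp in u.
pose M := (n %/ h)%N; have M0 : (0 < M)%N by rewrite divn_gt0.
have Mp : (M <= p)%N by rewrite (leq_trans _ np)// leq_div.
have l := psi_ge_count M0 Mp; rewrite cp in l.
have pR : 0 < p%:R :> R by rewrite ltr0n.
have nR : 0 < n%:R :> R by rewrite ltr0n.
have hR : 0 < h%:R :> R by rewrite ltr0n.
have ln0 := lnn_ge0 R n; have lM0 := lnn_ge0 R M.
have Mn : M%:R <= d * n%:R.
  have : M%:R * h%:R <= n%:R :> R by rewrite -natrM ler_nat leq_trunc_div.
  have : 2 <= d * h%:R by rewrite mulrC -ler_pdivrMr.
  move=> i1 i2; rewrite -(ler_pM2r hR); nra.
have lM : (1 - d) * ln n%:R <= ln M%:R.
  have : ln n%:R <= ln (2 * h%:R * M%:R) :> R.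
    rewrite -!natrM; apply: ler_lnn => //; apply: ltnW.
    apply: (leq_trans (ltn_ceil n h0)); rewrite -/M mulnAC leq_mul2r.
    by apply/orP; right; clear -M0; lia.
  rewrite lnM ?posrE ?mulr_gt0 ?ltr0n//.
  move: h3; rewrite ler_pdivrMr// => h3; lra.
have X0 : 0 <= n%:R * ln n%:R :> R by rewrite mulr_ge0.
set X := n%:R * ln n%:R in X0 *.
move: h2; rewrite ler_norml => /andP[b1 b2].
have up : (1 - d) * ((1 - d) * p%:R) <= (1 + d) * X.
  apply: (@le_trans _ _ ((1 - d) * (n%:R * ln p%:R))).
    by rewrite ler_wpM2l//; lra.
  rewrite mulrCA [(1 + d) * X]mulrCA ler_wpM2l//.
have lo : (1 - d) * ((1 - d) * X) <= (1 + d) * p%:R.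
  have i1 : (n%:R * (1 - d)) * ((1 - d) * ln n%:R) <= (n%:R - M%:R) * ln M%:R.
    apply: ler_pM => //; rewrite ?mulr_ge0//; lra.
  apply: (@le_trans _ _ (psi p)); last lra.
  by apply: le_trans l; move: i1; rewrite /X; lra.
exact: (ratio_bound d0 d8 de X0 (ltW pR) up lo).
Qed.

End PrimeCounting.

(** * The alternating sums of primes *)

Lemma A_succ n :
  A n.+1 = A n + ((nth_prime (2 * n).+2)%:Z - (nth_prime (2 * n).+1)%:Z).
Proof.
rewrite /A mulnS !addSn add0n big_nat_recr//= big_nat_recr//=.
have s : (-1) ^+ (2 * n) = 1 :> int by rewrite exprM sqrrN expr1n.
by rewrite !exprS s; ring.
Qed.

(** A_n is a sum of gaps p_(2j) - p_(2j-1) > 0, so the absolute value changes nothing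
    ([A_altsum]). *)
Definition altsum n : nat := `|A n|%N.

Lemma A_altsum n : A n = (altsum n)%:Z.
Proof.
suff h : (0 <= A n)%R by rewrite /altsum gez0_abs.
elim: n => [|n IH]; first by rewrite /A big_geq.
rewrite A_succ addr_ge0// subr_ge0 lez_nat ltnW//.
exact: nth_prime_lt.
Qed.

Lemma altsum0 : altsum 0 = 0%N.
Proof. by rewrite /altsum /A big_geq. Qed.

Lemma altsum_ltS n : (altsum n < altsum n.+1)%N.
Proof.
have := A_succ n; rewrite !A_altsum.
have : (nth_prime (2 * n).+1 < nth_prime (2 * n).+2)%N.
  exact: nth_prime_lt.
lia.
Qed.

Lemma altsum_mono : {mono altsum : m n / (m <= n)%N}.
Proof.
apply: leq_mono; apply: homo_ltn; first exact: ltn_trans.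
exact: altsum_ltS.
Qed.

Lemma leq_altsum n : (n <= altsum n)%N.
Proof. by elim: n => // n IH; rewrite (leq_ltn_trans IH)// altsum_ltS. Qed.

(** The predicate inside [prime_term], so [prime_term k] unfolds to [kth_nat altprime k]. *)
Definition altprime q : bool :=
  prime q && `[< exists2 n : nat, (1 <= n)%N & A n = q%:Z >].

Definition altcount n := count (fun i => primez (A i)) (index_iota 1 n.+1).

Lemma altprimeP q :
  reflect (prime q /\ exists2 n, (0 < n)%N & altsum n = q) (altprime q).
Proof.
apply: (iffP andP) => -[pq h]; split=> //.
  move/asboolP: h => [n n0 nq]; exists n => //.
  by move: nq; rewrite A_altsum => -[].
by apply/asboolP; case: h => n n0 nq; exists n => //; rewrite A_altsum nq.
Qed.

Lemma altcountS n : altcount n.+1 = (altcount n + prime (altsum n.+1))%N.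
Proof.
rewrite /altcount /index_iota !subSS !subn0 -[in LHS](addn1 n) iotaD.
by rewrite count_cat/= addn0 add1n A_altsum.
Qed.

Lemma altcount_le n : (altcount n <= n)%N.
Proof.
by rewrite (leq_trans (count_size _ _))// size_iota subSS subn0.
Qed.

(** No term of the sequence lies strictly between A_n and A_(n+1), so counting by value and by index
    agree. *)
Lemma count_altprime n : count altprime (iota 0 (altsum n).+1) = altcount n.
Proof.
elim: n => [|n IH].
  by rewrite altsum0 /altcount/= addn0.
have lt := altsum_ltS n.
rewrite -(subnKC (ltnW lt : (altsum n).+1 <= (altsum n.+1).+1)%N) iotaD.
rewrite count_cat IH.
rewrite add0n altcountS; congr addn.
have -> : ((altsum n.+1).+1 - (altsum n).+1 =
    (altsum n.+1 - (altsum n).+1) + 1)%N by lia.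
rewrite iotaD count_cat subnKC//= addn0.
have -> : altprime (altsum n.+1) = prime (altsum n.+1).
  by apply/altprimeP/idP => [[]//|pp]; split => //; exists n.+1.
rewrite (eq_in_count (a2 := pred0)) ?count_pred0// => q.
rewrite mem_iota subnKC// => /andP[q1 q2]; apply/altprimeP => -[_ [m m0 mq]].
move: q1 q2; rewrite -mq !ltnNge !altsum_mono; lia.
Qed.

(** If no prime term were >= m, [altcount] could not grow past index m and would stay at most m. So
    [kth_natP] applies, and [count_altprime] identifies the index. *)
Lemma prime_termP : (forall B, exists n, (B <= altcount n)%N) ->
  forall k, (0 < k)%N ->
  exists n, [/\ (k <= n)%N, altcount n = k & prime_term k = altsum n].
Proof.
move=> unb k k0.
have infP m : exists2 q, (m <= q)%N & altprime q.
  have [n hn] := unb m.+1.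
  have mn : (m < n)%N by rewrite (leq_trans hn)// altcount_le.
  apply: contrapT => hno; move: hn; apply/negP; rewrite -leqNgt.
  rewrite -(subnKC (ltnW mn)); elim: (n - m)%N => [|j IH].
    by rewrite addn0 altcount_le.
  rewrite addnS altcountS; case: (boolP (prime _)) => [pp|_]; last by rewrite addn0.
  exfalso; apply: hno; exists (altsum (m + j).+1).
    by rewrite (leq_trans _ (leq_altsum _))// leqW// leq_addr.
  by apply/altprimeP; split => //; exists (m + j).+1.
have [/altprimeP[_ [n n0 an]] cn] := kth_natP infP k0.
exists n; have ck : altcount n = k by rewrite -count_altprime an.
by split => //; rewrite -ck altcount_le.
Qed.

(** * Asymptotics of A_n under the two hypotheses *)

Section AlternatingSums.
Variable R : realType.
Implicit Types (n m N d k p q : nat).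

(** Pillai's sum at the even index 2 n is - A_n; this carries hypothesis (i) over to [altsum]. *)
Lemma altsum_norm n :
  `| \sum_(1 <= i < (2 * n).+1) (-1) ^+ (i - 1) * (nth_prime i)%:R : R |
  = (altsum n)%:R.
Proof.
have -> : \sum_(1 <= i < (2 * n).+1) (-1) ^+ (i - 1) * (nth_prime i)%:R
   = - (A n)%:~R :> R.
  rewrite /A rmorph_sum -sumrN; apply: eq_big_nat => i /andP[i0 _].
  have s : (-1) ^+ i = - (-1) ^+ (i - 1) :> R.
    by rewrite -{1}(prednK i0) exprS mulN1r subn1.
  by rewrite rmorphM rmorphXn/= rmorphN1 s mulNr opprK.
by rewrite normrN A_altsum ger0_norm.
Qed.

Lemma ratio_cvg (f g : nat -> R) :
  (\forall n \near \oo, 0 < g n) ->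
  (forall e : R, 0 < e -> \forall n \near \oo, `|f n - g n| <= e * `|g n|) ->
  f n / g n @[n --> \oo] --> (1 : R).
Proof.
move=> g0 h; apply/cvgrPdist_le => e e0; near=> n.
have gn : 0 < g n by near: n.
have hn : `|f n - g n| <= e * `|g n| by near: n; exact: h.
have -> : 1 - f n / g n = - ((f n - g n) / g n).
  by rewrite mulrBl divff ?gt_eqF// opprB.
by rewrite normrN normrM normfV ler_pdivrMr// normr_gt0 gt_eqF.
Unshelve. all: by end_near. Qed.

Lemma equiv_ratio_cvg (f g : nat -> R) :
  (\forall n \near \oo, 0 < g n) -> f ~_\oo g ->
  f n / g n @[n --> \oo] --> (1 : R).
Proof. by move=> g0 /eqaddoP h; apply: ratio_cvg. Qed.

Lemma cvgM1 (f g : nat -> R) :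
  f n @[n --> \oo] --> (1 : R) -> g n @[n --> \oo] --> (1 : R) ->
  f n * g n @[n --> \oo] --> (1 : R).
Proof. by move=> f1 g1; rewrite -(mulr1 1); exact: cvgM. Qed.

Lemma cvgV1 (f : nat -> R) :
  f n @[n --> \oo] --> (1 : R) -> (f n)^-1 @[n --> \oo] --> (1 : R).
Proof. by move=> f1; rewrite -invr1; apply: cvgV. Qed.

Lemma near_ln_ge (B : R) : \forall n \near \oo, B <= ln n%:R.
Proof. by have [M [_ hM]] := ln_ge_real B; exists M. Qed.

Lemma near_lnln (e : R) : 0 < e ->
  \forall n \near \oo, 0 <= ln (ln (n%:R : R)) <= e * ln n%:R.
Proof.
move=> e0; near=> n.
have l1 : 1 <= ln n%:R :> R by near: n; exact: near_ln_ge.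
have l2 : (2 / e) ^+ 2 <= ln n%:R :> R by near: n; exact: near_ln_ge.
rewrite ln_ge0//=; set L := ln n%:R in l1 l2 *.
have L0 : 0 < L by lra.
have e2 : 0 <= 2 / e by rewrite divr_ge0// ltW.
apply: (le_trans (ln_le_2sqrt L0)).
have h : 2 / e <= Num.sqrt L.
  by rewrite -ler_sqr ?nnegrE ?sqrtr_ge0// sqr_sqrtr// ltW.
rewrite ler_pdivrMr// in h.
have s0 := sqrtr_ge0 L.
rewrite -[in leRHS](sqr_sqrtr (ltW L0)); nra.
Unshelve. all: by end_near. Qed.

Lemma near_nat_ge N : \forall n \near \oo, (N <= n)%N.
Proof. by exists N. Qed.

Lemma ln_double_ratio : ln (2 * n)%:R / ln n%:R @[n --> \oo] --> (1 : R).
Proof.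
apply: ratio_cvg => [|e e0]; near=> n.
  have : 1 <= ln n%:R :> R by near: n; exact: near_ln_ge.
  lra.
have n0 : (0 < n)%N by near: n; exact: near_nat_ge.
have l : e^-1 <= ln n%:R :> R by near: n; exact: near_ln_ge.
rewrite natrM lnM ?posrE ?ltr0n// addrK (ger0_norm (lnn_ge0 _ n)).
have := @ln_le_subr1 R 2 ltac:(lra).
have -> : `|ln 2| = ln 2 :> R by rewrite ger0_norm// lnn_ge0.
have : 1 <= e * ln n%:R by rewrite mulrC -ler_pdivrMr// mul1r.
lra.
Unshelve. all: by end_near. Qed.

Lemma nth_prime_ratio :
  (nth_prime n)%:R / (n%:R * ln n%:R) @[n --> \oo] --> (1 : R).
Proof.
have pos : \forall n \near \oo, 0 < n%:R * ln n%:R :> R.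
  near=> n; have l : 1 <= ln n%:R :> R by near: n; exact: near_ln_ge.
  rewrite mulr_gt0 ?ltr0n//; last by lra.
  by near: n; exact: near_nat_ge.
apply: ratio_cvg => // e e0; near=> n.
have gn : 0 < n%:R * ln n%:R :> R by near: n.
rewrite (gtr0_norm gn); near: n.
by have [N0 hN0] := nth_prime_asymp e0; exists N0.
Unshelve. all: by end_near. Qed.

Section Hypotheses.
Hypothesis pillai :
  (fun k : nat => `| \sum_(1 <= i < k.+1) (-1) ^+ (i - 1) * (nth_prime i)%:R : R |)
    ~_\oo (fun k : nat => (nth_prime k)%:R / 2 : R).
Hypothesis prime_count :
  (fun n : nat => (count (fun i => primez (A i)) (index_iota 1 n.+1))%:R : R)
    ~_\oo (fun n : nat => 2 * n%:R / ln n%:R : R).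

Lemma cvg_double : (2 * n)%N @[n --> \oo] --> \oo.
Proof. exact: cvg_mulnl. Qed.

Lemma altsum_ratio :
  (altsum n)%:R / ((nth_prime (2 * n))%:R / 2) @[n --> \oo] --> (1 : R).
Proof.
have h : \forall k \near \oo, 0 < (nth_prime k)%:R / 2 :> R.
  near=> k; rewrite divr_gt0// ltr0n prime_gt0//.
  by have [] := @nth_primeP k => //; near: k; exact: near_nat_ge.
have := cvg_comp _ _ cvg_double (equiv_ratio_cvg h pillai).
by apply: cvg_trans; apply: near_eq_cvg; near=> n; rewrite /= altsum_norm.
Unshelve. all: by end_near. Qed.

Lemma altcount_ratio :
  (altcount n)%:R / (2 * n%:R / ln n%:R) @[n --> \oo] --> (1 : R).
Proof.
apply: equiv_ratio_cvg prime_count; near=> n.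
have l : 1 <= ln n%:R :> R by near: n; exact: near_ln_ge.
rewrite divr_gt0 ?mulr_gt0 ?ltr0n//; last by lra.
by near: n; exact: near_nat_ge.
Unshelve. all: by end_near. Qed.

Lemma altcount_half_bounds : \forall n \near \oo,
  n%:R <= (altcount n)%:R * ln (n%:R : R) <= 3 * n%:R.
Proof.
have /cvgrPdist_le/(_ 2^-1 ltac:(lra)) h := altcount_ratio.
near=> n.
have l : 1 <= ln n%:R :> R by near: n; exact: near_ln_ge.
have n0 : (0 < n)%N by near: n; exact: near_nat_ge.
have nR : 0 < n%:R :> R by rewrite ltr0n.
have : `|1 - (altcount n)%:R / (2 * n%:R / ln n%:R)| <= 2^-1 :> R by near: n.
have -> : (altcount n)%:R / (2 * n%:R / ln n%:R) =
   ((altcount n)%:R * ln n%:R) / (2 * n%:R) :> R.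
  by rewrite invf_div mulrA.
rewrite ler_norml => /andP[a b].
have n2 : 0 < 2 * n%:R :> R by lra.
have c : (altcount n)%:R * ln n%:R / (2 * n%:R) <= 3 / 2 :> R by lra.
have d : 1 / 2 <= (altcount n)%:R * ln n%:R / (2 * n%:R) :> R by lra.
rewrite ler_pdivrMr// in c; rewrite ler_pdivlMr// in d.
by apply/andP; split; lra.
Unshelve. all: by end_near. Qed.

Lemma altcount_unbounded B : exists n, (B <= altcount n)%N.
Proof.
have B1 : 0 < (B%:R + 1)^-1 :> R by rewrite invr_gt0 ltr_wpDl.
have [M [_ hM]] := ln_le_eps B1.
suff : \forall n \near \oo, (B <= altcount n)%N.
  by case=> N _ /(_ N (leqnn N)); exists N.
near=> n.
have l : 1 <= ln n%:R :> R by near: n; exact: near_ln_ge.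
have : ln n%:R <= (B%:R + 1)^-1 * n%:R :> R.
  by apply: hM; near: n; exact: near_nat_ge.
have : n%:R <= (altcount n)%:R * ln (n%:R : R) <= 3 * n%:R.
  by near: n; exact: altcount_half_bounds.
move=> /andP[h _].
rewrite ler_pdivlMl ?ltr_wpDl// => h2.
rewrite -(ler_nat R) -(ler_pM2r (_ : 0 < ln n%:R)); lra.
Unshelve. all: by end_near. Qed.

(** The logarithm of [altcount_half_bounds] gives log (altcount n) + log log n = log n + O(1), and
    log log n = o(log n). *)
Lemma ln_altcount_ratio :
  ln (altcount n)%:R / ln n%:R @[n --> \oo] --> (1 : R).
Proof.
apply: ratio_cvg => [|e e0].
  near=> n; have : 1 <= ln n%:R :> R by near: n; exact: near_ln_ge.
  lra.
have e2 : 0 < e / 2 by lra.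
near=> n.
have n0 : (0 < n)%N by near: n; exact: near_nat_ge.
have nR : 0 < n%:R :> R by rewrite ltr0n.
have l1 : 1 <= ln n%:R :> R by near: n; exact: near_ln_ge.
have l : 2 / (e / 2) <= ln n%:R :> R by near: n; exact: near_ln_ge.
have : n%:R <= (altcount n)%:R * ln (n%:R : R) <= 3 * n%:R.
  by near: n; exact: altcount_half_bounds.
have : 0 <= ln (ln (n%:R : R)) <= e / 2 * ln n%:R by near: n; exact: near_lnln.
move=> /andP[ll0 ll] /andP[c1 c2].
have L0 : 0 < ln n%:R :> R by lra.
have c0 : 0 < (altcount n)%:R :> R.
  rewrite -(pmulr_lgt0 _ L0); lra.
have d1 : ln n%:R <= ln ((altcount n)%:R * ln n%:R) :> R.
  by rewrite ler_ln ?posrE ?mulr_gt0.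
have d2 : ln ((altcount n)%:R * ln n%:R) <= ln (3 * n%:R) :> R.
  by rewrite ler_ln ?posrE ?mulr_gt0.
move: d1 d2; rewrite !lnM ?posrE// => d1 d2.
have := @ln_le_subr1 R 3 ltac:(lra) => l3.
rewrite ler_pdivrMr// in l.
rewrite (ger0_norm (lnn_ge0 _ n)) ler_norml; apply/andP; split; lra.
Unshelve. all: by end_near. Qed.

Lemma altsum_altcount_ratio :
  (altsum n)%:R / (2^-1 * (altcount n)%:R * ln (altcount n)%:R ^+ 2)
    @[n --> \oo] --> (1 : R).
Proof.
have c1 := cvg_comp _ _ cvg_double nth_prime_ratio.
have v1 := cvgV1 altcount_ratio.
have v2 := cvgV1 ln_altcount_ratio.
(* In the product of these six ratios p_(2n), n, log (2n) and log n cancel, which leaves the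
   required quotient. *)
have := cvgM1 (cvgM1 (cvgM1 altsum_ratio c1) ln_double_ratio)
  (cvgM1 v1 (cvgM1 v2 v2)).
apply: cvg_trans; apply: near_eq_cvg.
near=> n.
have n0 : (0 < n)%N by near: n; exact: near_nat_ge.
have l1 : 1 <= ln n%:R :> R by near: n; exact: near_ln_ge.
have nR : n%:R != 0 :> R by rewrite pnatr_eq0 -lt0n.
have lR : ln n%:R != 0 :> R by rewrite gt_eqF//; lra.
have l2 : ln (2 * n)%:R != 0 :> R.
  rewrite gt_eqF// natrM lnM ?posrE ?ltr0n//.
  have := lnn_ge0 R 2; lra.
have pR : (nth_prime (2 * n))%:R != 0 :> R.
  rewrite pnatr_eq0 -lt0n prime_gt0//.
  by have [] := @nth_primeP (2 * n) => //; rewrite muln_gt0.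
rewrite /= natrM in l2 *.
rewrite !invfM !invrK.
set c := (altcount n)%:R^-1; set L := (ln (altcount n)%:R)^-1.
by field; rewrite nR lR l2 pR.
Unshelve. all: by end_near. Qed.

End Hypotheses.

(** Intermediate value theorem in s = log R: the function vanishes at -c/2, and at (t + |c|) / 2
    both exp s >= 1 and c + 2 s >= t. *)
Lemma expR_cube_solution (c t : R) : 0 <= t -> exists2 s : R,
  0 <= c + 2 * s & expR s ^+ 3 * (c + 2 * s) = t.
Proof.
move=> t0; pose G (s : R) : R := expR s ^+ 3 * (c + 2 * s).
have ab : - (c / 2) <= (t + `|c|) / 2.
  by have := ler_norm (- c); rewrite normrN; lra.
have Ga : G (- (c / 2)) = 0 by rewrite /G (_ : c + 2 * _ = 0) ?mulr0//; lra.
have Gb : t <= G ((t + `|c|) / 2).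
  rewrite /G; have cc : 0 <= c + `|c|.
    by have := ler_norm (- c); rewrite normrN; lra.
  have e1 : 1 <= expR ((t + `|c|) / 2).
    have := expR_ge1Dx ((t + `|c|) / 2); have := normr_ge0 c; lra.
  have e3 : 1 <= expR ((t + `|c|) / 2) ^+ 3 by rewrite exprn_ege1.
  have : 1 * (c + 2 * ((t + `|c|) / 2)) <=
     expR ((t + `|c|) / 2) ^+ 3 * (c + 2 * ((t + `|c|) / 2)).
    rewrite ler_wpM2r//; lra.
  lra.
have cG : continuous G.
  move=> x; apply: cvgM.
    exact: (continuous_comp (@continuous_expR R x)
      (@exprn_continuous R 3 (expR x))).
  by apply: cvgD; [exact: cvg_cst|apply: cvgM; [exact: cvg_cst|exact: cvg_id]].
have [||s] := @IVT R G _ _ t ab.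
- exact: continuous_subspaceT.
- rewrite Ga; apply/andP; split; first by rewrite ge_min t0.
  by rewrite le_max Gb orbT.
rewrite in_itv/= => /andP[s1 s2] Gs; exists s => //; lra.
Qed.

End AlternatingSums.

(** * Convergence of the solutions R_k *)

Section EquationForRk.
Variable R : realType.

(** If R = exp s exceeds 1 + d, then s > 0 and the left side is more than (1 + d) log k. If R < 1 -
    d, then s < 0 and it is at most (1 - d)^3 (1 + d) log k <= (1 - d) log k. Both contradict |1 -
    rho k| <= d/2. *)
Lemma expR_cube_solution_cvg (s rho : nat -> R) :
  rho k @[k --> \oo] --> (1 : R) ->
  (forall k, 0 <= ln k%:R + ln (ln k%:R) + 2 * s k) ->
  (forall k, expR (s k) ^+ 3 * (ln k%:R + ln (ln k%:R) + 2 * s k) =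
     rho k * ln k%:R) ->
  expR (s k) @[k --> \oo] --> (1 : R).
Proof.
move=> /cvgrPdist_le rho1 s0 sE; apply/cvgrPdist_le => e e0.
pose d := Num.min e 2^-1.
have d0 : 0 < d by rewrite lt_min e0; lra.
have d2 : d <= 2^-1 by rewrite ge_min lexx orbT.
have de : d <= e by rewrite ge_min lexx.
have dh : 0 < d / 2 by lra.
near=> k.
have l1 : 1 <= ln k%:R :> R by near: k; exact: near_ln_ge.
have : `|1 - rho k| <= d / 2 by near: k; exact: rho1.
have : 0 <= ln (ln (k%:R : R)) <= d * ln k%:R by near: k; exact: near_lnln.
rewrite ler_norml => /andP[ll0 ll] /andP[r1 r2].
have := sE k; have := s0 k; set E := expR (s k).
have E0 : 0 < E by exact: expR_gt0.
set L := ln k%:R in l1 ll0 ll *; set LL := ln L in ll0 ll * => h0 hE.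
have E30 : 0 < E ^+ 3 by rewrite exprn_gt0.
apply: (le_trans _ de); rewrite ler_norml; apply/andP; split.
  rewrite lerBrDr addrC -lerBrDr opprK leNgt; apply/negP => Eg.
  have sp : 0 < s k by rewrite -expR_gt1 -/E; lra.
  have : E * L <= E ^+ 3 * (L + LL + 2 * s k).
    apply: ler_pM; [exact: ltW|lra| |lra].
    rewrite exprS ler_peMr ?(ltW E0)// exprn_ege1//; lra.
  have : (1 + d) * L < E * L by rewrite ltr_pM2r; lra.
  have : rho k * L <= (1 + d / 2) * L by rewrite ler_wpM2r; lra.
  have : d / 2 * L < d * L by rewrite ltr_pM2r; lra.
  lra.
rewrite lerBlDr -lerBlDl leNgt; apply/negP => El.
have sn : s k < 0 by rewrite -expR_lt1 -/E; lra.
have i1 : E ^+ 3 * (L + LL + 2 * s k) <= (1 - d) ^+ 3 * ((1 + d) * L).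
  apply: ler_pM => //; [exact: ltW| |lra].
  by rewrite lerXn2r ?nnegrE ?(ltW E0)//; lra.
have i2 : (1 - d) ^+ 3 * ((1 + d) * L) <= (1 - d) * L.
  rewrite mulrA ler_wpM2r//; first by lra.
  have -> : (1 - d) ^+ 3 * (1 + d) = (1 - d) * ((1 - d) * (1 - d * d)) by ring.
  rewrite ler_piMr//; first by lra.
  by apply: mulr_ile1; nra.
have : (1 - d / 2) * L <= rho k * L by rewrite ler_wpM2r; lra.
have : d / 2 * L < d * L by rewrite ltr_pM2r; lra.
lra.
Unshelve. all: by end_near. Qed.

End EquationForRk.

Theorem theorem2p8 (R : realType)
  (pillai :
    (fun k : nat =>
       `| \sum_(1 <= i < k.+1) (-1) ^+ (i - 1) * (nth_prime i)%:R : R |)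
    ~_\oo (fun k : nat => (nth_prime k)%:R / 2 : R))
  (prime_count :
    (fun n : nat => (count (fun i => primez (A i)) (index_iota 1 n.+1))%:R : R)
    ~_\oo (fun n : nat => 2 * n%:R / ln n%:R : R)) :
  exists Rk : nat -> R,
    [/\ forall k : nat, (2 <= k)%N -> 0 < Rk k,
        Rk k @[k --> \oo] --> (1 : R)
      & forall k : nat, (2 <= k)%N ->
          (prime_term k)%:R =
            2^-1 * Rk k ^+ 3 * k%:R * ln k%:R *
              (ln k%:R + ln (ln k%:R) + 2 * ln (Rk k))].
Proof.
(* [nk k] is the index of the k-th prime term, with a dummy value at k = 0. *)
have /choice[nk hnk] : forall k, exists n, (0 < k)%N ->
    [/\ (k <= n)%N, altcount n = k & prime_term k = altsum n].
  move=> k; case: (posnP k) => [->|k0]; first by exists 0%N.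
  have [n hn] := prime_termP (altcount_unbounded prime_count) k0.
  by exists n.
have nkoo : nk k @[k --> \oo] --> \oo.
  apply/cvgnyPge => B; exists B.+1 => // k /= Bk.
  have [|h _ _] := hnk k; first by rewrite (leq_trans _ Bk).
  by rewrite (leq_trans _ h)// ltnW.
pose rho k : R := (prime_term k)%:R / (2^-1 * k%:R * ln k%:R ^+ 2).
have rho1 : rho k @[k --> \oo] --> (1 : R).
  have := cvg_comp _ _ nkoo (altsum_altcount_ratio pillai prime_count).
  apply: cvg_trans; apply: near_eq_cvg; exists 1%N => // k /= k0.
  by have [_ ck rk] := hnk k k0; rewrite /rho ck rk.
(* The equation divided by (k log k) / 2, in the unknown s = log R_k. Its right-hand side is
   nonnegative for every k, so a solution always exists. *)
have /choice[s hs] : forall k, exists s : R,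
   0 <= ln k%:R + ln (ln k%:R) + 2 * s /\
   expR s ^+ 3 * (ln k%:R + ln (ln k%:R) + 2 * s) = rho k * ln k%:R.
  move=> k; have [|s s0 sE] :=
    @expR_cube_solution R (ln k%:R + ln (ln k%:R)) (rho k * ln k%:R).
    by rewrite /rho mulr_ge0 ?lnn_ge0// divr_ge0// ?mulr_ge0 ?exprn_ge0 ?lnn_ge0.
  by exists s.
exists (fun k => expR (s k)); split=> [k _||k k2]; first exact: expR_gt0.
  by apply: (expR_cube_solution_cvg rho1) => k; have [] := hs k.
have [_ sE] := hs k.
have k0 : k%:R != 0 :> R by rewrite pnatr_eq0; lia.
have l0 : ln k%:R != 0 :> R by rewrite gt_eqF// ln_gt0// ltr1n.
rewrite expRK.
have -> : 2^-1 * expR (s k) ^+ 3 * k%:R * ln k%:R *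
   (ln k%:R + ln (ln k%:R) + 2 * s k) =
   2^-1 * k%:R * ln k%:R *
   (expR (s k) ^+ 3 * (ln k%:R + ln (ln k%:R) + 2 * s k)) by ring.
rewrite sE /rho; field; by rewrite k0 l0.
Qed.
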